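(* Let $G=(V=[n],E)$ be a graph with positive node weights $w\in\mathbb{R}^V$ ($w_i>0$ for all $i\in V$), and let $B\in\mathcal{M}^*(G,w)$. Then the following holds. (i) $p_B^{(r)}=\frac{1}{\alpha(G,w)}$ for some $r\in\mathbb{N}$. (ii) $\Theta_B^{(r)}=\frac{1}{\alpha(G,w)}$ for some $r\in\mathbb{N}$. In particular, if $G$ has no $w$-critical edge, then (i) and (ii) hold for any matrix $B\in\mathcal{M}(G,w)$ and thus for the matrix $B_w$.
   Context: Graphs are finite and simple. For $S\subseteq V$, $w(S)=\sum_{i\in S}w_i$. $\alpha(G,w)$ is the maximum of $w(S)$ over stable sets $S$ of $G$ (sets containing no edge); a stable set attaining it is called $w$-maximum. An edge $\{i,j\}\in E$ is $w$-critical if there exists $R\subseteq V$ such that both $R\cup\{i\}$ and $R\cup\{j\}$ are $w$-maximum stable sets. $\mathcal{S}^n$ is the set of real symmetric $n\times n$ matrices. $B_w\in\mathcal{S}^n$ has entries $(B_w)_{ii}=1/w_i$, $(B_w)_{ij}=\frac12(1/w_i+1/w_j)$ if $\{i,j\}\in E$, and $(B_w)_{ij}=0$ if $i\neq j$, $\{i,j\}\notin E$. $\mathcal{M}(G,w)$ is the set of $B\in\mathcal{S}^n$ with $B_{ii}=1/w_i$ for $i\in V$, $B_{ij}\ge\frac12(B_{ii}+B_{jj})$ for $\{i,j\}\in E$, and $B_{ij}=0$ for $i\ne j$, $\{i,j\}\notin E$. $\mathcal{M}^*(G,w)$ is the set of $B\in\mathcal{M}(G,w)$ with $2B_{ij}>B_{ii}+B_{jj}$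 for all $w$-critical edges $\{i,j\}\in E$. For $M\in\mathcal{S}^n$ set $p_M(x)=x^TMx$. $\Sigma$ is the set of sums of squares of real polynomials in $x=(x_1,\dots,x_n)$. The truncated quadratic module is $\mathcal{M}(x_1,\dots,x_n)_r=\{\sigma_0+\sum_{j=1}^n\sigma_jx_j:\sigma_j\in\Sigma,\ \deg(\sigma_0)\le 2r,\ \deg(\sigma_jx_j)\le 2r\}$, and the truncated ideal is $\langle h\rangle_{k}=\{uh:u\in\mathbb{R}[x],\deg(uh)\le k\}$. For $r\ge1$, $$p_M^{(r)}=\sup\Big\{\lambda\in\mathbb{R}: p_M-\lambda\in\mathcal{M}(x_1,\dots,x_n)_r+\Big\langle\sum_{i=1}^nx_i-1\Big\rangle_{2r}\Big\}$$ (with $\sup\emptyset=-\infty$; the supremum is attained when the program is feasible). For $r\ge0$, $\mathcal{K}^{(r)}_n=\{M\in\mathcal{S}^n:(\sum_{i=1}^nx_i^2)^r\sum_{i,j}M_{ij}x_i^2x_j^2\in\Sigma\}$, and $\Theta_M^{(r)}=\max\{\lambda\in\mathbb{R}:M-\lambda J\in\mathcal{K}_n^{(r)}\}$, with $J$ the all-ones matrix. *)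

(* Defs.v *)
From HB Require Import structures.
From mathcomp Require Import all_boot all_order all_algebra.
(* mpoly has to be imported before classical_sets: in the other order the two
   files declare incompatible notation levels. *)
From mathcomp Require Import mpoly.
From mathcomp Require Import classical_sets reals constructive_ereal ereal.

Set Implicit Arguments.
Unset Strict Implicit.
Unset Printing Implicit Defensive.

Import Order.TTheory GRing.Theory Num.Theory.
Local Open Scope ring_scope.

(* A graph on [n] is given by its adjacency relation e : rel 'I_n, symmetric and
   irreflexive. *)
Section WeightedGraphs.
Variables (R : realType) (n : nat) (e : rel 'I_n) (w : 'I_n -> R).

Definition stable (S : {set 'I_n}) : bool :=
  [forall i in S, forall j in S, ~~ e i j].

Definition weight (S : {set 'I_n}) : R := \sum_(i in S) w i.

(* The default value 0 of the iterated maximum is the weight of set0, which is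
   always stable, so this is a maximum attained by some stable set. *)
Definition alpha : R := \big[Num.max/0]_(S : {set 'I_n} | stable S) weight S.

Definition wmaximum (S : {set 'I_n}) : bool := stable S && (weight S == alpha).

Definition wcritical (i j : 'I_n) : bool :=
  e i j && [exists S : {set 'I_n}, wmaximum (i |: S) && wmaximum (j |: S)].

Definition Bw : 'M[R]_n :=
  \matrix_(i, j) if i == j then (w i)^-1
                 else if e i j then 2^-1 * ((w i)^-1 + (w j)^-1)
                 else 0.

Definition MGw (B : 'M[R]_n) : Prop :=
  [/\ B^T = B,
      forall i, B i i = (w i)^-1,
      forall i j, e i j -> 2^-1 * (B i i + B j j) <= B i j &
      forall i j, i != j -> ~~ e i j -> B i j = 0].

Definition MGw_star (B : 'M[R]_n) : Prop :=
  MGw B /\ forall i j, wcritical i j -> B i i + B j j < 2 * B i j.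

End WeightedGraphs.

Section Hierarchies.
Variables (R : realType) (n : nat).
Implicit Types (p q u : {mpoly R[n]}) (M : 'M[R]_n).

(* msize p is one more than the total degree of p (and 0 for p = 0). *)
Definition deg_le (d : nat) p : bool := (msize p <= d.+1)%N.

Definition sos p : Prop :=
  exists s : seq {mpoly R[n]}, p = \sum_(q <- s) q ^+ 2.

Definition quad_module (r : nat) p : Prop :=
  exists (s0 : {mpoly R[n]}) (s : 'I_n -> {mpoly R[n]}),
    [/\ sos s0 /\ (forall j, sos (s j)),
        deg_le (2 * r) s0,
        forall j, deg_le (2 * r) (s j * 'X_j) &
        p = s0 + \sum_(j < n) s j * 'X_j].

Definition trunc_ideal (h : {mpoly R[n]}) (k : nat) p : Prop :=
  exists2 u, deg_le k (u * h) & p = u * h.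

Definition qform M : {mpoly R[n]} :=
  \sum_(i < n) \sum_(j < n) M i j *: ('X_i * 'X_j).

Definition p_feasible M (r : nat) (l : R) : Prop :=
  exists q h, [/\ quad_module r q,
    trunc_ideal (\sum_(i < n) 'X_i - 1) (2 * r) h &
    qform M - l%:MP = q + h].

(* Extended-real valued: -oo if the program is infeasible. *)
Definition p_bound M (r : nat) : \bar R :=
  ereal_sup [set l%:E | l in [set l : R | p_feasible M r l]]%classic.

Definition Kcone (r : nat) M : Prop :=
  M^T = M /\
  sos ((\sum_(i < n) 'X_i ^+ 2) ^+ r *
       \sum_(i < n) \sum_(j < n) M i j *: ('X_i ^+ 2 * 'X_j ^+ 2)).

Definition Theta_feasible M (r : nat) (l : R) : Prop :=
  Kcone r (M - l *: const_mx 1).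

(* "t is the maximum of the program defining Theta": t is attained. *)
Definition is_Theta M (r : nat) (t : R) : Prop :=
  Theta_feasible M r t /\ forall l, Theta_feasible M r l -> l <= t.

End Hierarchies.

(* Main.v *)
(* Let f = x^T B x - 1/alpha.  On the simplex f is nonnegative (weighted
   Motzkin-Straus), and B in M* forces its zeros to be the finitely many points z_S,
   S a w-maximum stable set.  At z_S strict complementarity holds (df/dx_i > 0 off S)
   and f is positive definite on the face of S, so up to terms of order three at z_S
   one has f = d |x - z_S|^2 + m with d > 0 and m in the quadratic module M generated
   by the x_i and +-(sum x_i - 1).  The module M is archimedean, so strictly positive
   polynomials belong to it (Putinar; here by Zorn's lemma).  The zeros are then
   removed one at a time: f = m' + |x - z|^2 f' with m' in M and f' having the same
   properties at the remaining zeros only; when no zero is left Putinar applies.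
   This gives (i).  For (ii), substitute x_i^2 for x_i and homogenise the resulting
   identity modulo sum x_i^2 - 1. *)
Require Import Defs.
From mathcomp Require Import all_boot all_order all_algebra.
From mathcomp Require Import mpoly.
From mathcomp Require Import boolp classical_sets reals constructive_ereal ereal.
From mathcomp Require Import ring lra zify.
(* Imported again: mpoly and classical_sets shadow symmetric, subsetP, set0, ... *)
From mathcomp Require Import ssrbool fintype finset.

Set Implicit Arguments.
Unset Strict Implicit.
Unset Printing Implicit Defensive.

Import Order.TTheory GRing.Theory Num.Theory.
Local Open Scope ring_scope.

(** * Archimedean quadratic modules *)

(** The obstacle is that f vanishes on the simplex, whereas Putinar's theorem needs strict
    positivity. As no bound on r is asked for, degrees are ignored: f is placed in the full
    quadratic module, and r is read off the finished certificate. The opposite inequalities come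
    from evaluation at some z_S. No topology is used. Positive lower bounds come from a certificate
    s g - 1 in M together with a constant bound on s, and cutting a ball around a zero out of the
    domain means adjoining one more generator. Hence the analytic lemmas are stated for arbitrary
    archimedean modules rather than for the simplex. Dividing by |x - z|^2 must not spoil the other
    zeros. The quotient is v F plus a multiple of a screening factor that vanishes to order four at
    those zeros, and v is positive there, so local positivity survives. *)

Lemma mpoly_ring_ind (R : nzRingType) (n : nat) (P : {mpoly R[n]} -> Prop) :
  (forall c, P c%:MP) -> (forall i, P 'X_i) ->
  (forall p q, P p -> P q -> P (p + q)) ->
  (forall p q, P p -> P q -> P (p * q)) -> forall p, P p.
Proof.
move=> PC PX PD PM; elim/mpolyind => [|c m p _ _ Pp]; first by rewrite -mpolyC0.
apply: (PD) => //; rewrite -mul_mpolyC; apply: (PM) => //.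
rewrite mpolyXE_id; apply: (big_ind P) => [|//|i _]; first by rewrite -mpolyC1.
by elim: (m i) => [|k IH]; rewrite ?expr0 -?mpolyC1 // exprS; apply: PM.
Qed.

Section SumsOfSquares.
Variables (R : realType) (n : nat).
Implicit Types (p q : {mpoly R[n]}).

Lemma sos0 : sos (0 : {mpoly R[n]}).
Proof. by exists [::]; rewrite big_nil. Qed.

Lemma sos_sqr p : sos (p ^+ 2).
Proof. by exists [:: p]; rewrite big_seq1. Qed.

Lemma sos_add p q : sos p -> sos q -> sos (p + q).
Proof. by case=> s -> [t ->]; exists (s ++ t); rewrite big_cat. Qed.

Lemma sos_sum (I : Type) (r : seq I) (P : pred I) (F : I -> {mpoly R[n]}) :
  (forall i, P i -> sos (F i)) -> sos (\sum_(i <- r | P i) F i).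
Proof. by move=> sF; apply: big_ind => //; [exact: sos0|exact: sos_add]. Qed.

Lemma sos_sqrM p q : sos p -> sos (q ^+ 2 * p).
Proof.
case=> s ->; rewrite mulr_sumr; apply: sos_sum => r _.
by rewrite -exprMn; exact: sos_sqr.
Qed.

Lemma sosM p q : sos p -> sos q -> sos (p * q).
Proof.
by case=> s -> sq; rewrite mulr_suml; apply: sos_sum => r _; exact: sos_sqrM.
Qed.

Lemma sosC (c : R) : 0 <= c -> sos (c%:MP : {mpoly R[n]}).
Proof. by move=> c0; rewrite -(sqr_sqrtr c0) rmorphXn; exact: sos_sqr. Qed.

Lemma sos_exp p k : sos p -> sos (p ^+ k).
Proof.
move=> sp; elim: k => [|k IH]; last by rewrite exprS; exact: sosM.
by rewrite expr0 -(expr1n _ 2); exact: sos_sqr.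
Qed.

Lemma sos_ge0 p (x : 'I_n -> R) : sos p -> 0 <= p.@[x].
Proof.
case=> s ->; rewrite raddf_sum /=; apply: sumr_ge0 => q _.
by rewrite rmorphXn /= sqr_ge0.
Qed.

End SumsOfSquares.

Section QuadraticModules.
Variables (R : realType) (n : nat).
Implicit Types (p q g : {mpoly R[n]}) (M Q : {mpoly R[n]} -> Prop).

Definition qmodule M : Prop :=
  [/\ M 1, forall p q, M p -> M q -> M (p + q) &
      forall p q, M p -> M (q ^+ 2 * p)].

Definition archimedean M : Prop := forall p, exists N : R, M (N%:MP - p).

Definition nonneg_locus M (x : 'I_n -> R) : Prop := forall p, M p -> 0 <= p.@[x].

Section Basics.
Variable M : {mpoly R[n]} -> Prop.
Hypothesis qM : qmodule M.

Lemma qmD p q : M p -> M q -> M (p + q).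
Proof. by case: qM => _ + _; apply. Qed.

Lemma qm_sqrM p q : M p -> M (q ^+ 2 * p).
Proof. by case: qM => _ _; apply. Qed.

Lemma qm_sqr q : M (q ^+ 2).
Proof. by rewrite -[_ ^+ 2]mulr1; apply: qm_sqrM; case: qM. Qed.

Lemma qm0 : M 0.
Proof. by have := qm_sqr 0; rewrite expr0n. Qed.

Lemma qm_sum (I : Type) (r : seq I) (P : pred I) (F : I -> {mpoly R[n]}) :
  (forall i, P i -> M (F i)) -> M (\sum_(i <- r | P i) F i).
Proof. by move=> sF; apply: big_ind => //; [exact: qm0|exact: qmD]. Qed.

Lemma qm_sosM p s : sos s -> M p -> M (s * p).
Proof.
by case=> t -> Mp; rewrite mulr_suml; apply: qm_sum => q _; exact: qm_sqrM.
Qed.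

Lemma qm_sos s : sos s -> M s.
Proof. by move=> ss; rewrite -[s]mulr1; apply: qm_sosM => //; case: qM. Qed.

Lemma qmC (c : R) : 0 <= c -> M c%:MP.
Proof. by move=> c0; apply/qm_sos/sosC. Qed.

Lemma qmZ (c : R) p : 0 <= c -> M p -> M (c *: p).
Proof. by move=> c0 Mp; rewrite -mul_mpolyC; apply: qm_sosM => //; exact: sosC. Qed.

Lemma qmZ_inv (c : R) p : 0 < c -> M (c *: p) -> M p.
Proof.
move=> c0 /(qmZ (ltW (_ : 0 < c^-1))); rewrite invr_gt0 => /(_ c0).
by rewrite scalerA mulVf ?gt_eqF // scale1r.
Qed.

Lemma archimedean_ub : archimedean M -> forall p, exists2 N : R, 0 < N &
  M (N%:MP - p) /\ forall x, nonneg_locus M x -> `|p.@[x]| <= N.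
Proof.
move=> aM p; have [a Ma] := aM p; have [b Mb] := aM (- p).
pose N := `|a| + `|b| + 1.
have N0 : 0 < N by rewrite ltr_wpDl // addr_ge0.
have Na : 0 <= N - a by have := ler_norm a; have := normr_ge0 b; rewrite /N; lra.
have Nb : 0 <= N - b by have := ler_norm b; have := normr_ge0 a; rewrite /N; lra.
exists N => //; split.
  have -> : N%:MP - p = (N - a)%:MP + (a%:MP - p) by rewrite mpolyCB; ring.
  by apply: qmD => //; exact: qmC.
move=> x Kx; rewrite ler_norml.
have := Kx _ Ma; have := Kx _ Mb; rewrite !mevalB !mevalN !mevalC; lra.
Qed.

End Basics.

(** The quadratic module M + Sigma q generated by M and q; on the nonnegativity set it imposes the
    extra constraint q >= 0. *)
Definition qm_adjoin M q p : Prop := exists2 s, sos s & M (p - s * q).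

Lemma qm_adjoin_sub M q p : M p -> qm_adjoin M q p.
Proof. by exists 0; rewrite ?mul0r ?subr0 //; exact: sos0. Qed.

Lemma qm_adjoin_mem M q : qmodule M -> qm_adjoin M q q.
Proof.
move=> qM; exists (1 ^+ 2); first exact: sos_sqr.
by rewrite expr1n mul1r subrr; exact: qm0.
Qed.

Lemma qmodule_adjoin M q : qmodule M -> qmodule (qm_adjoin M q).
Proof.
move=> qM; split=> [|p r [s ss Mp] [t st Mr]|p r [s ss Mp]].
- by apply: qm_adjoin_sub; case: qM.
- exists (s + t); first exact: sos_add.
  have -> : p + r - (s + t) * q = (p - s * q) + (r - t * q) by ring.
  exact: qmD.
- exists (r ^+ 2 * s); first exact: sos_sqrM.
  have -> : r ^+ 2 * p - r ^+ 2 * s * q = r ^+ 2 * (p - s * q) by ring.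
  exact: qm_sqrM.
Qed.

Lemma archimedean_adjoin M q : archimedean M -> archimedean (qm_adjoin M q).
Proof. by move=> aM p; have [N] := aM p; exists N; exact: qm_adjoin_sub. Qed.

Lemma nonneg_locus_adjoin M q x : qmodule M ->
  nonneg_locus (qm_adjoin M q) x <-> nonneg_locus M x /\ 0 <= q.@[x].
Proof.
move=> qM; split=> [K|[K q0] p [s ss Mp]].
  by split=> [p Mp|]; apply: K; [exact: qm_adjoin_sub|exact: qm_adjoin_mem].
have := K _ Mp; rewrite mevalB mevalM subr_ge0; apply: le_trans.
by rewrite mulr_ge0 // sos_ge0.
Qed.

Lemma maximal_qm M : qmodule M -> ~ M (-1) -> exists Q,
  [/\ qmodule Q, ~ Q (-1), (forall p, M p -> Q p) & forall p, Q p \/ Q (- p)].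
Proof.
move=> qM M1.
(* Zorn is applied to sets A with M added back by [U]: the union of the empty chain is empty and is
   not itself a quadratic module. *)
pose U (A : set {mpoly R[n]}) p := A p \/ M p.
pose P A := qmodule (U A) /\ ~ U A (-1).
have [F FP Ftot|A [[qA A1] Amax]] := @Zorn_bigcup _ P.
  set W := (\bigcup_(X in F) X)%classic.
  have UW X p : F X -> U X p -> U W p by move=> FX [Xp|]; [left; exists X|right].
  have common p q : U W p -> U W q ->
      (M p /\ M q) \/ exists2 X, F X & U X p /\ U X q.
    move=> [[X FX Xp]|Mp] [[Y FY Yq]|Mq]; [right|right|right|by left].
    - have [XY|YX] := Ftot _ _ FX FY; first by exists Y => //; split; left=> //; exact: XY.
      by exists X => //; split; left=> //; exact: YX.
    - by exists X => //; split; [left|right].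
    - by exists Y => //; split; [right|left].
  split; last by move=> [[X FX X1]|//]; have [_] := FP _ FX; apply; left.
  split; first by right; case: qM.
  - move=> p q Wp Wq; have [[Mp Mq]|[X FX [Xp Xq]]] := common _ _ Wp Wq.
      by right; exact: qmD.
    by apply: (UW X) => //; have [qX _] := FP _ FX; exact: qmD.
  - move=> p q [[X FX Xp]|Mp]; last by right; exact: qm_sqrM.
    by apply: (UW X) => //; have [qX _] := FP _ FX; apply: qm_sqrM => //; left.
have step q : ~ U A q -> qm_adjoin (U A) q (-1).
  move=> Aq; apply: contrapT => N1; have qB := qmodule_adjoin q qA.
  apply: (Amax (qm_adjoin (U A) q)).
    split=> [|sub]; first by move=> p Ap; apply: qm_adjoin_sub; left.
    by apply: Aq; left; apply: sub; exact: qm_adjoin_mem.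
  have UE : U (qm_adjoin (U A) q) = qm_adjoin (U A) q.
    apply/funext => p; apply/propext; split=> [[//|Mp]|]; last by left.
    by apply: qm_adjoin_sub; right.
  by rewrite /P UE.
exists (U A); split=> // [p Mp|a]; first by right.
apply: contrapT => /not_orP [/step [s ss As] /step [t st At]].
(* From -1 - s a and -1 + t a in Q one gets s in Q \cap -Q, which is an ideal. *)
apply: (A1).
have sN : U A (- s).
  have -> : - s = t + t * (-1 - s * a) + s * (-1 - t * - a) by ring.
  by apply: (qmD qA); first apply: (qmD qA); [exact: (qm_sos qA)|exact: (qm_sosM qA)..].
(* Since s and -s are both in the module, 4 a = (a + 1)^2 - (a - 1)^2 puts s a in it, which cancels
   against -1 - s a. *)
have := qm_sqrM qA ((a + 1)) (qmZ qA _ (qm_sos qA ss)) => /(_ 4^-1).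
move=> /(_ ltac:(lra)) h1.
have := qm_sqrM qA ((a - 1)) (qmZ qA _ sN) => /(_ 4^-1).
move=> /(_ ltac:(lra)) h2.
have -> : -1 = (-1 - s * a) + ((a + 1) ^+ 2 * (4^-1 *: s) + (a - 1) ^+ 2 * (4^-1 *: - s)).
  rewrite -!mul_mpolyC.
  have e4 : (4^-1)%:MP * 4 = 1 :> {mpoly R[n]}.
    have -> : 4 = (4%:R)%:MP :> {mpoly R[n]} by rewrite mpolyC_nat.
    by rewrite -mpolyCM mulVf ?mpolyC1 //; lra.
  transitivity (-1 - s * a + ((4^-1)%:MP * 4) * (s * a)); last by ring.
  by rewrite e4; ring.
by apply: (qmD qA) => //; exact: (qmD qA).
Qed.

(** A quadratic module need not contain the product (N - p)(N + p) of two members; the factor 2 N =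
    (N - p) + (N + p) supplies the missing squares. *)
Lemma qm_sub_sqr Q p (N : R) : qmodule Q -> 0 < N ->
  Q (N%:MP - p) -> Q (N%:MP + p) -> Q ((N ^+ 2)%:MP - p ^+ 2).
Proof.
move=> qQ N0 h1 h2; apply: (@qmZ_inv _ qQ (2 * N)); first by rewrite mulr_gt0.
have -> : (2 * N) *: ((N ^+ 2)%:MP - p ^+ 2) =
   (N%:MP + p) ^+ 2 * (N%:MP - p) + (N%:MP - p) ^+ 2 * (N%:MP + p).
  rewrite -mul_mpolyC; ring.
by apply: qmD => //; exact: qm_sqrM.
Qed.

(** The polynomials bounded on both sides form a ring: squares are handled by [qm_sub_sqr], and
    products by polarisation. *)
Lemma archimedean_gen M : qmodule M ->
  (forall i, exists2 N : R, 0 < N & M (N%:MP - 'X_i) /\ M (N%:MP + 'X_i)) ->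
  archimedean M.
Proof.
move=> qM gX.
pose bd p := exists2 N : R, 0 < N & M (N%:MP - p) /\ M (N%:MP + p).
have bdD p q : bd p -> bd q -> bd (p + q).
  move=> [a a0 [pa pa']] [b b0 [qb qb']]; exists (a + b); first exact: addr_gt0.
  by split; [have := qmD qM pa qb|have := qmD qM pa' qb'];
    congr M; rewrite mpolyCD; ring.
have bdZ c p : bd p -> bd (c *: p).
  move=> [a a0 [pa pa']]; exists (`|c| * a + 1);
    first by rewrite ltr_wpDl // mulr_ge0 // ltW.
  have e : `|c| *: (a%:MP : {mpoly R[n]}) = (`|c| * a)%:MP.
    by rewrite -mul_mpolyC -mpolyCM.
  have [c0|c0] := leP 0 c.
    have h1 := qmZ qM c0 pa; have h2 := qmZ qM c0 pa'.
    rewrite (ger0_norm c0) in e *.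
    by split; [have := qmD qM (qmC qM ler01) h1|have := qmD qM (qmC qM ler01) h2];
      congr M; rewrite ?scalerDr ?scalerN e mpolyCD; ring.
  have c1 : 0 <= - c by lra.
  have h1 := qmZ qM c1 pa; have h2 := qmZ qM c1 pa'.
  rewrite (ltr0_norm c0) in e *.
  by split; [have := qmD qM (qmC qM ler01) h2|have := qmD qM (qmC qM ler01) h1];
     congr M; rewrite ?scalerDr ?scalerN e mpolyCD scaleNr; ring.
have bd_sqr p : bd p -> bd (p ^+ 2).
  move=> [a a0 [pa pa']]; exists (a ^+ 2); first by rewrite exprn_gt0.
  split; first exact: qm_sub_sqr.
  by apply: qmD => //; [apply: qmC => //; rewrite sqr_ge0|exact: qm_sqr].
suff bdA p : bd p by move=> p; have [N _ [? _]] := bdA p; exists N.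
elim/mpoly_ring_ind: p => [c|i|p q|p q] //.
- exists (`|c| + 1); first by rewrite ltr_wpDl.
  by rewrite -mpolyCB -mpolyCD; split; apply: (qmC qM); have := ler_norm c;
    have := ler_norm (- c); rewrite normrN; lra.
- exact: bdD.
move=> bp bq.
have -> : p * q = 4^-1 *: ((p + q) ^+ 2 + (-1) *: (p + (-1) *: q) ^+ 2).
  rewrite !scaleN1r.
  have -> : (p + q) ^+ 2 - (p - q) ^+ 2 = 4%:R *: (p * q) by rewrite scaler_nat; ring.
  by rewrite scalerA mulVf ?scale1r //; lra.
by apply/bdZ/bdD; [|apply: (bdZ)]; apply: bd_sqr; apply: (bdD) => //; exact: bdZ.
Qed.

(** * Points of total archimedean quadratic modules *)

Section Point.
Variable Q : {mpoly R[n]} -> Prop.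
Hypotheses (qQ : qmodule Q) (aQ : archimedean Q) (Q1 : ~ Q (-1)).
Hypothesis Qtot : forall p, Q p \/ Q (- p).

(* p is infinitely close to r in the ordering defined by Q. *)
Let near p (r : R) := forall e : R, 0 < e ->
  Q (p - (r - e)%:MP) /\ Q ((r + e)%:MP - p).

Let Qneg (c : R) : Q c%:MP -> 0 <= c.
Proof.
move=> Qc; rewrite leNgt; apply/negP => c0; apply: Q1.
apply: (@qmZ_inv _ qQ (- c)); first by rewrite oppr_gt0.
by rewrite scalerN scaleNr opprK -mul_mpolyC mulr1.
Qed.

Let near_ex p : exists r, near p r.
Proof.
pose S (r : R) : Prop := Q (p - r%:MP).
have [N QN] := aQ p; have [N' QN'] := aQ (- p).
have ubS (r : R) : Q (p - r%:MP) -> r <= N.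
  move=> /(qmD qQ QN) h; rewrite -subr_ge0; apply: Qneg.
  by move: h; rewrite mpolyCB; congr Q; ring.
have supS : has_sup (S : set R).
  split; last by exists N => r; exact: ubS.
  exists (- N'); rewrite /S mpolyCN opprK addrC.
  by move: QN'; rewrite opprK.
(* The lower half is adherence of the supremum. For the upper half, totality would otherwise put sup
   S + e into S. *)
exists (sup S) => e e0; split.
  have [r Sr lt_r] := sup_adherent e0 supS.
  have -> : p - (sup S - e)%:MP = (p - r%:MP) + (r - (sup S - e))%:MP.
    by rewrite !mpolyCB; ring.
  by apply: (qmD qQ) => //; apply: (qmC qQ); rewrite subr_ge0 ltW.
have [h|] := Qtot (p - (sup S + e)%:MP); last by rewrite opprB.
have : sup S + e <= sup S by apply: ub_le_sup => //; case: supS.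
lra.
Qed.

Let nearC c : near c%:MP c.
Proof. by move=> e e0; rewrite -!mpolyCB; split; apply: (qmC qQ); lra. Qed.

Let nearD p q r s : near p r -> near q s -> near (p + q) (r + s).
Proof.
move=> np nq e e0; have e2 : 0 < e / 2 by lra.
have [p1 p2] := np _ e2; have [q1 q2] := nq _ e2.
split; [have := qmD qQ p1 q1|have := qmD qQ p2 q2]; congr Q;
  rewrite [in RHS](splitr e) !(mpolyCD, mpolyCB); ring.
Qed.

Let nearN p r : near p r -> near (- p) (- r).
Proof.
move=> np e e0; have [p1 p2] := np _ e0.
by split; [have := p2|have := p1]; congr Q; rewrite !(mpolyCD, mpolyCB, mpolyCN); ring.
Qed.

Let nearZ c p r : near p r -> near (c *: p) (c * r).
Proof.
wlog c0 : c / 0 < c => [hw|] np.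
  have [c0|c0|c0] := ltgtP 0 c; first exact: hw.
    rewrite -[c]opprK scaleNr mulNr; apply: nearN; apply: hw => //; lra.
  by rewrite -c0 scale0r mul0r -mpolyC0; exact: nearC.
move=> e e0; have ec : 0 < e / c by rewrite divr_gt0.
have [p1 p2] := np _ ec.
split; [have := qmZ qQ (ltW c0) p1|have := qmZ qQ (ltW c0) p2]; congr Q;
  rewrite -!mul_mpolyC mulrBr -mpolyCM; congr (_ - _); rewrite ?(mulrBr, mulrDr);
  by rewrite mulrCA divff ?gt_eqF // mulr1.
Qed.

Let near0_sqr p : near p 0 -> near (p ^+ 2) 0.
Proof.
move=> np e e0; have s0 : 0 < Num.sqrt e by rewrite sqrtr_gt0.
have [p1 p2] := np _ s0.
split; first by rewrite sub0r mpolyCN opprK; apply: (qmD qQ);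
  [exact: qm_sqr|apply: (qmC qQ); exact: ltW].
rewrite add0r -[e]sqr_sqrtr ?ltW //; apply: (qm_sub_sqr qQ) => //.
  by move: p2; rewrite add0r.
by move: p1; rewrite sub0r mpolyCN opprK addrC.
Qed.

Let near_sqr p r : near p r -> near (p ^+ 2) (r ^+ 2).
Proof.
move=> np.
have h0 : near (p - r%:MP) 0 by rewrite -(subrr r); apply/nearD/nearN/nearC.
have := nearD (nearD (near0_sqr h0) (nearZ (2 * r) np)) (nearC (- r ^+ 2)).
congr near; last by ring.
rewrite -mul_mpolyC; ring.
Qed.

Let nearM p q r s : near p r -> near q s -> near (p * q) (r * s).
Proof.
move=> np nq.
have := nearZ 2^-1 (nearD (near_sqr (nearD np nq)) (nearN (nearD (near_sqr np) (near_sqr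
  nq)))).
congr near; last by field.
have -> : (p + q) ^+ 2 - (p ^+ 2 + q ^+ 2) = 2%:R *: (p * q) by rewrite scaler_nat; ring.
by rewrite scalerA mulVf ?scale1r //; lra.
Qed.

(** The point collects the reals infinitely close to the variables. Closeness respects the ring
    operations, so every p is close to p(x); if p in Q had p(x) < 0, the negative constant p(x) / 2
    would lie in Q. *)
Lemma total_qm_point : exists x, nonneg_locus Q x.
Proof.
have [x nX] := choice (fun i : 'I_n => near_ex 'X_i).
exists x => p Qp.
have np : near p p.@[x].
  elim/mpoly_ring_ind: {Qp} p => [c|i|p q np nq|p q np nq].
  - by rewrite mevalC; exact: nearC.
  - by rewrite mevalXU.
  - by rewrite mevalD; exact: nearD.
  - by rewrite mevalM; exact: nearM.
rewrite leNgt; apply/negP => p0.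
have [_ h] := np (- p.@[x] / 2) ltac:(lra).
have := Qneg (_ : Q ((p.@[x] + - p.@[x] / 2)%:MP)).
suff -> : (p.@[x] + - p.@[x] / 2)%:MP = ((p.@[x] + - p.@[x] / 2)%:MP - p) + p.
  by move=> /(_ (qmD qQ h Qp)); lra.
by rewrite subrK.
Qed.

End Point.

Theorem qm_point M : qmodule M -> archimedean M -> ~ M (-1) ->
  exists x, nonneg_locus M x.
Proof.
move=> qM aM M1; have [Q [qQ Q1 MQ Qtot]] := maximal_qm qM M1.
have aQ : archimedean Q by move=> p; have [N MN] := aM p; exists N; exact: MQ.
have [x Kx] := total_qm_point qQ aQ Q1 Qtot.
by exists x => p Mp; apply: Kx; exact: MQ.
Qed.

(** Adjoining -g leaves no point in the nonnegativity set, so by [qm_point] the enlarged module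
    contains -1. *)
Lemma positivstellensatz M g : qmodule M -> archimedean M ->
  (forall x, nonneg_locus M x -> 0 < g.@[x]) -> exists2 s, sos s & M (s * g - 1).
Proof.
move=> qM aM g0.
have [[s ss Ms]|h] := pselect (qm_adjoin M (- g) (-1)).
  by exists s => //; move: Ms; congr M; ring.
have [x /nonneg_locus_adjoin[//|/g0 gx]] :=
  qm_point (qmodule_adjoin (- g) qM) (archimedean_adjoin (- g) aM) h.
by rewrite mevalN; lra.
Qed.

(** This replaces compactness: s g >= 1 and s <= N force g >= 1 / N. *)
Lemma pos_lower_bound M g : qmodule M -> archimedean M ->
  (forall x, nonneg_locus M x -> 0 < g.@[x]) ->
  exists2 c : R, 0 < c & forall x, nonneg_locus M x -> c <= g.@[x].
Proof.
move=> qM aM g0; have [s ss Ms] := positivstellensatz qM aM g0.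
have [N N0 [_ sN]] := archimedean_ub qM aM s.
exists N^-1; rewrite ?invr_gt0 // => x Kx.
have := Kx _ Ms; rewrite mevalB mevalM meval1 subr_ge0 => h.
have := le_trans (ler_norm _) (sN _ Kx) => h2.
rewrite -[_^-1]mul1r ler_pdivrMr //; apply: le_trans h _; rewrite mulrC.
by rewrite ler_wpM2l // ltW // g0.
Qed.

(* Putinar's theorem.  With s g - 1 in M, adding a nonnegative constant r to g can
   be undone in steps of size 1/k^2. *)
Theorem putinar M g : qmodule M -> archimedean M ->
  (forall x, nonneg_locus M x -> 0 < g.@[x]) -> M g.
Proof.
move=> qM aM g0; have [s ss Ms] := positivstellensatz qM aM g0.
have [k1 k10 [Mk1 _]] := archimedean_ub qM aM s.
have [k2 k20 [Mk2 _]] := archimedean_ub qM aM (s ^+ 2 * g).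
have [N N0 [Mr _]] := archimedean_ub qM aM (- g).
pose k := k1 + k2 + 1.
have k0 : 0 < k by rewrite /k; lra.
have Mk1' : M ((2 * k)%:MP - s).
  have -> : (2 * k)%:MP - s = (2 * k - k1)%:MP + (k1%:MP - s) by rewrite mpolyCB; ring.
  by apply: (qmD qM) => //; apply: qmC => //; rewrite /k; lra.
have Mk2' : M ((2 * k - 1)%:MP - s ^+ 2 * g).
  have -> : (2 * k - 1)%:MP - s ^+ 2 * g = (2 * k - 1 - k2)%:MP + (k2%:MP - s ^+ 2 * g).
    by rewrite [in RHS]mpolyCB; ring.
  by apply: (qmD qM) => //; apply: qmC => //; rewrite /k; lra.
have step (r : R) : 0 <= r -> M (g + r%:MP) -> M (g + (r - (k ^+ 2)^-1)%:MP).
  move=> r0 Mgr; apply: (@qmZ_inv _ qM (k ^+ 2)); first exact: exprn_gt0.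
  (* The certificate is k^2 (g + r) - 1 = (k - s)^2 (g + r) + 2 k (s g - 1) + r s (2 k - s) + (2 k -
     1 - s^2 g); k was chosen to put the last two brackets in M. *)
  have := qmD qM (qmD qM (qmD qM (qm_sqrM qM (k%:MP - s) Mgr)
    (qmZ qM (ltW (mulr_gt0 (@ltr0Sn R 1) k0)) Ms)) (qmZ qM r0 (qm_sosM qM ss Mk1'))) Mk2'.
  congr M; rewrite -!mul_mpolyC [in RHS]mulrDr -[in RHS]mpolyCM [in RHS]mulrBr mulfV
    ?gt_eqF ?exprn_gt0 //.
  rewrite !(mpolyCD, mpolyCB, mpolyCM, mpolyC1) ?rmorphXn /= ?mpolyC_nat; ring.
pose d := (k ^+ 2)^-1.
have d0 : 0 < d by rewrite invr_gt0 exprn_gt0.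
(* The step requires a nonnegative constant. Once the constant has become negative, adding its
   opposite yields g itself. *)
have H j : M g \/ M (g + (N - j%:R * d)%:MP).
  elim: j => [|j [|Mj]]; [|by left|].
    by right; rewrite mul0r subr0 addrC; move: Mr; rewrite opprK.
  have [r0|r0] := leP 0 (N - j%:R * d).
    right; have := step _ r0 Mj; congr M; congr (_ + _%:MP).
    by rewrite -/d -natr1; ring.
  left; have := qmD qM Mj (qmC qM (_ : 0 <= - (N - j%:R * d))).
  rewrite mpolyCN addrK; apply; lra.
have [j hj] : exists j : nat, N / d < j%:R.
  by exists (Num.bound (N / d)); apply: archi_boundP; rewrite divr_ge0 ?ltW.
have [//|Mj] := H j.
have := qmD qM Mj (qmC qM (_ : 0 <= - (N - j%:R * d))).
rewrite mpolyCN addrK; apply; move: hj; rewrite ltr_pdivrMr //; lra.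
Qed.

End QuadraticModules.

(** * Nondegenerate zeros *)

Section LocalStructure.
Variables (R : realType) (n : nat).
Implicit Types (p q u F : {mpoly R[n]}) (M : {mpoly R[n]} -> Prop).
Implicit Types (z x : 'I_n -> R).

Definition shiftX z (k : 'I_n) : {mpoly R[n]} := 'X_k - (z k)%:MP.

Definition dist2 z : {mpoly R[n]} := \sum_k shiftX z k ^+ 2.

(* Square of the maximal ideal of z, resp. its cube (through vanishing e k l). *)
Definition ideal_sqr z p : Prop := exists e : 'I_n -> 'I_n -> {mpoly R[n]},
  p = \sum_k \sum_l shiftX z k * shiftX z l * e k l.

Definition ideal_cube z p : Prop := exists2 e : 'I_n -> 'I_n -> {mpoly R[n]},
  forall k l, (e k l).@[z] = 0 &
  p = \sum_k \sum_l shiftX z k * shiftX z l * e k l.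

Definition locally_pos M z F : Prop := exists (d : R) m p,
  [/\ 0 < d, M m, ideal_cube z p & F = d *: dist2 z + m + p].

Lemma shiftXE z k x : (shiftX z k).@[x] = x k - z k.
Proof. by rewrite mevalB mevalXU mevalC. Qed.

Lemma dist2E z x : (dist2 z).@[x] = \sum_k (x k - z k) ^+ 2.
Proof.
by rewrite raddf_sum /=; apply: eq_bigr => k _; rewrite rmorphXn /= shiftXE.
Qed.

Lemma dist2_ge0 z x : 0 <= (dist2 z).@[x].
Proof. by rewrite dist2E; apply: sumr_ge0 => k _; rewrite sqr_ge0. Qed.

Lemma dist2_self z : (dist2 z).@[z] = 0.
Proof. by rewrite dist2E big1 // => k _; rewrite subrr expr0n. Qed.

Lemma dist2_coord z x k : (x k - z k) ^+ 2 <= (dist2 z).@[x].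
Proof.
rewrite dist2E (bigD1 k) //= lerDl; apply: sumr_ge0 => l _; exact: sqr_ge0.
Qed.

Lemma dist2_eq0 z x : (dist2 z).@[x] = 0 -> x =1 z.
Proof.
move=> h k; apply/eqP; rewrite -subr_eq0 -sqrf_eq0 eq_le sqr_ge0 andbT -h.
exact: dist2_coord.
Qed.

Lemma sos_dist2 z : sos (dist2 z).
Proof. by apply: sos_sum => k _; exact: sos_sqr. Qed.

Lemma vanish_lin z p : exists e : 'I_n -> {mpoly R[n]},
  p - (p.@[z])%:MP = \sum_k shiftX z k * e k.
Proof.
elim/mpoly_ring_ind: p => [c|i|p q [e pE] [f qE]|p q [e pE] [f qE]].
- exists (fun=> 0); rewrite mevalC subrr big1 // => k _; exact: mulr0.
- exists (fun k => (k == i)%:R); rewrite mevalXU (bigD1 i) //= eqxx mulr1.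
  by rewrite big1 ?addr0 // => k /negPf ->; rewrite mulr0.
- exists (fun k => e k + f k); rewrite mevalD mpolyCD opprD addrACA pE qE -big_split.
  by apply: eq_bigr => k _; rewrite /= -mulrDr.
- exists (fun k => e k * q + (p.@[z])%:MP * f k).
  rewrite mevalM mpolyCM.
  have -> : p * q - (p.@[z])%:MP * (q.@[z])%:MP =
     (p - (p.@[z])%:MP) * q + (p.@[z])%:MP * (q - (q.@[z])%:MP) by ring.
  rewrite pE qE mulr_suml mulr_sumr -big_split; apply: eq_bigr => k _ /=; ring.
Qed.

Lemma vanish_lin0 z p : p.@[z] = 0 -> exists e : 'I_n -> {mpoly R[n]},
  p = \sum_k shiftX z k * e k.
Proof.
by move=> p0; have [e] := vanish_lin z p; rewrite p0 mpolyC0 subr0; exists e.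
Qed.

Lemma ideal_sqrD z p q : ideal_sqr z p -> ideal_sqr z q -> ideal_sqr z (p + q).
Proof.
move=> [e ->] [f ->]; exists (fun k l => e k l + f k l).
rewrite -big_split; apply: eq_bigr => k _ /=; rewrite -big_split /=.
by apply: eq_bigr => l _; rewrite -mulrDr.
Qed.

Lemma ideal_sqr0 z : ideal_sqr z 0.
Proof.
by exists (fun _ _ => 0); rewrite big1 // => k _; rewrite big1 // => l _; rewrite mulr0.
Qed.

Lemma ideal_sqrM z p q : p.@[z] = 0 -> q.@[z] = 0 -> ideal_sqr z (p * q).
Proof.
move=> /vanish_lin0[e ->] /vanish_lin0[f ->]; exists (fun k l => e k * f l).
rewrite mulr_suml; apply: eq_bigr => k _; rewrite mulr_sumr.
by apply: eq_bigr => l _; ring.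
Qed.

Lemma ideal_cubeM z p q : ideal_sqr z p -> q.@[z] = 0 -> ideal_cube z (p * q).
Proof.
move=> [e ->] q0; exists (fun k l => e k l * q) => [k l|]; first by rewrite mevalM q0 mulr0.
rewrite mulr_suml; apply: eq_bigr => k _; rewrite mulr_suml.
by apply: eq_bigr => l _; rewrite mulrA.
Qed.

Lemma ideal_cube_sqr z p : ideal_cube z p -> ideal_sqr z p.
Proof. by case=> e _ ->; exists e. Qed.

Lemma ideal_cubeD z p q : ideal_cube z p -> ideal_cube z q -> ideal_cube z (p + q).
Proof.
move=> [e e0 ->] [f f0 ->]; exists (fun k l => e k l + f k l).
  by move=> k l; rewrite mevalD e0 f0 addr0.
rewrite -big_split; apply: eq_bigr => k _ /=; rewrite -big_split /=.
by apply: eq_bigr => l _; rewrite -mulrDr.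
Qed.

Lemma ideal_cube0 z : ideal_cube z 0.
Proof.
exists (fun _ _ => 0) => [k l|]; first by rewrite meval0.
by rewrite big1 // => k _; rewrite big1 // => l _; rewrite mulr0.
Qed.

Lemma ideal_cube_sum z (I : Type) (r : seq I) (P : pred I) (G : I -> {mpoly R[n]}) :
  (forall i, P i -> ideal_cube z (G i)) -> ideal_cube z (\sum_(i <- r | P i) G i).
Proof.
by move=> h; apply: big_ind => //; [exact: ideal_cube0|exact: ideal_cubeD].
Qed.

Lemma ideal_cube_mull z p q : ideal_cube z p -> ideal_cube z (q * p).
Proof.
move=> [e e0 ->]; exists (fun k l => q * e k l).
  by move=> k l; rewrite mevalM e0 mulr0.
rewrite mulr_sumr.
by apply: eq_bigr => k _; rewrite mulr_sumr; apply: eq_bigr => l _; ring.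
Qed.

Lemma ideal_sqr_eval z p : ideal_sqr z p -> p.@[z] = 0.
Proof.
case=> e ->; rewrite raddf_sum big1 // => k _; rewrite raddf_sum big1 // => l _ /=.
by rewrite !mevalM shiftXE subrr !mul0r.
Qed.

Lemma ideal_sqr_dist2 z : ideal_sqr z (dist2 z).
Proof.
apply: (big_ind (ideal_sqr z)); [exact: ideal_sqr0|exact: ideal_sqrD|move=> k _].
by rewrite expr2; apply: ideal_sqrM; rewrite shiftXE subrr.
Qed.

(* Truncating the Taylor series of the square root of u at z. *)
Lemma sqrt_mod_ideal_sqr z u : 0 < u.@[z] ->
  exists q, ideal_sqr z (u - q ^+ 2).
Proof.
move=> u0; have [e uE] := vanish_lin z u.
pose c := Num.sqrt u.@[z]; have c0 : 0 < c by rewrite sqrtr_gt0.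
have cE : u.@[z] = c ^+ 2 by rewrite sqr_sqrtr // ltW.
pose w := \sum_k ((e k).@[z]) *: shiftX z k.
have w0 : w.@[z] = 0.
  rewrite raddf_sum big1 // => k _ /=.
  by rewrite mevalZ shiftXE subrr mulr0.
exists (c%:MP + (2 * c)^-1 *: w).
have -> : u - (c%:MP + (2 * c)^-1 *: w) ^+ 2 =
   (\sum_k shiftX z k * (e k - (e k).@[z]%:MP)) + (- ((2 * c)^-1 ^+ 2)%:MP * w) * w.
  have -> : \sum_k shiftX z k * (e k - (e k).@[z]%:MP) = u - (c ^+ 2)%:MP - w.
    rewrite -cE uE /w -sumrB; apply: eq_bigr => k _; rewrite mulrBr -mul_mpolyC; ring.
  rewrite -mul_mpolyC.
  have e1 : (2 * c)%:MP * ((2 * c)^-1)%:MP = 1 :> {mpoly R[n]}.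
    by rewrite -mpolyCM divff ?mpolyC1 // mulf_neq0 // gt_eqF.
  transitivity (u - (c ^+ 2)%:MP - ((2 * c)%:MP * ((2 * c)^-1)%:MP) * w
     - (((2 * c)^-1) ^+ 2)%:MP * w * w).
    by set i := _^-1; ring.
  by rewrite e1; ring.
apply: ideal_sqrD; last by apply: ideal_sqrM => //; rewrite mevalM w0 mulr0.
apply: (big_ind (ideal_sqr z)); [exact: ideal_sqr0|exact: ideal_sqrD|move=> k _].
by apply: ideal_sqrM; [rewrite shiftXE subrr|rewrite mevalB mevalC subrr].
Qed.

(** Since u m may leave M, u is replaced there by a square q^2 equal to u modulo the squared ideal
    of z. As F vanishes at z so does m, hence the error (u - q^2) m is of third order. *)
Lemma locally_pos_mul M z u F : qmodule M -> F.@[z] = 0 -> 0 < u.@[z] ->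
  locally_pos M z F -> locally_pos M z (u * F).
Proof.
move=> qM F0 u0 [d [m [p [d0 Mm pz FE]]]].
have m0 : m.@[z] = 0.
  move: F0; rewrite FE !mevalD mevalZ dist2_self mulr0 add0r.
  by rewrite (ideal_sqr_eval (ideal_cube_sqr pz)) addr0.
have [q hq] := sqrt_mod_ideal_sqr u0.
exists (d * u.@[z]), (q ^+ 2 * m),
  (dist2 z * (d%:MP * (u - (u.@[z])%:MP)) + ((u - q ^+ 2) * m + u * p)).
split; [exact: mulr_gt0|exact: qm_sqrM| |].
  apply: ideal_cubeD.
    apply: ideal_cubeM; first exact: ideal_sqr_dist2.
    by rewrite mevalM mevalB !mevalC subrr mulr0.
  apply: ideal_cubeD; first exact: ideal_cubeM.
  exact: ideal_cube_mull.
rewrite FE -!mul_mpolyC mpolyCM; ring.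
Qed.

Lemma locally_posD_cube M z F p : locally_pos M z F -> ideal_cube z p ->
  locally_pos M z (F + p).
Proof.
move=> [d [m [q [d0 Mm qz FE]]]] pz; exists d, m, (q + p).
by split=> //; [exact: ideal_cubeD|rewrite FE addrA].
Qed.

Section Bounds.
Variable M : {mpoly R[n]} -> Prop.
Hypotheses (qM : qmodule M) (aM : archimedean M).
Let K := nonneg_locus M.

(** A Lipschitz estimate, squared to stay polynomial. The induction concerns p - p(z), because the
    parts of a sum or product vanishing at z need not vanish there. *)
Lemma vanish_bound z p : p.@[z] = 0 -> exists2 C : R, 0 < C &
  forall x, K x -> p.@[x] ^+ 2 <= C * (dist2 z).@[x].
Proof.
move=> p0; suff [C C0 h] : exists2 C : R, 0 < C &
    forall x, K x -> (p.@[x] - p.@[z]) ^+ 2 <= C * (dist2 z).@[x].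
  by exists C => // x /h; rewrite p0 subr0.
elim/mpoly_ring_ind: {p0} p => [c|i|p q [a a0 pa] [b b0 qb]|p q [a a0 pa] [b b0 qb]].
- exists 1 => // x Kx; rewrite !mevalC subrr expr0n mul1r; exact: dist2_ge0.
- exists 1 => // x Kx; rewrite !mevalXU mul1r; exact: dist2_coord.
- exists (2 * a + 2 * b) => [|x Kx]; first by lra.
  have := pa _ Kx; have := qb _ Kx; rewrite !mevalD.
  have := sqr_ge0 ((p.@[x] - p.@[z]) - (q.@[x] - q.@[z])).
  nra.
- have [N N0 [_ hN]] := archimedean_ub qM aM q.
  exists (2 * (a * N ^+ 2 + p.@[z] ^+ 2 * b)) => [|x Kx].
    by rewrite mulr_gt0 // ltr_wpDr ?mulr_gt0 ?exprn_gt0 // mulr_ge0 ?sqr_ge0 // ltW.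
  have h1 := pa _ Kx; have h2 := qb _ Kx; rewrite !mevalM.
  have q2 : q.@[x] ^+ 2 <= N ^+ 2.
    by rewrite -(ger0_norm (sqr_ge0 _)) normrX lerXn2r ?nnegrE ?normr_ge0 ?(ltW N0) ?hN.
  set P := p.@[x]; set P0 := p.@[z] in h1 *; set Q := q.@[x] in h2 q2 *.
  set Q0 := q.@[z] in h2 *; set D := (dist2 z).@[x] in h1 h2 *.
  have D0 : 0 <= D by exact: dist2_ge0.
  have e1 : (P - P0) ^+ 2 * Q ^+ 2 <= a * D * N ^+ 2.
    by apply: ler_pM => //; exact: sqr_ge0.
  have e2 : P0 ^+ 2 * (Q - Q0) ^+ 2 <= P0 ^+ 2 * (b * D).
    by apply: ler_wpM2l => //; exact: sqr_ge0.
  have e3 := sqr_ge0 ((P - P0) * Q - P0 * (Q - Q0)).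
  have -> : (P * Q - P0 * Q0) ^+ 2 = 2 * ((P - P0) ^+ 2 * Q ^+ 2) +
    2 * (P0 ^+ 2 * (Q - Q0) ^+ 2)
     - ((P - P0) * Q - P0 * (Q - Q0)) ^+ 2 by ring.
  have -> : 2 * (a * N ^+ 2 + P0 ^+ 2 * b) * D = 2 * (a * D * N ^+ 2) +
    2 * (P0 ^+ 2 * (b * D)) by ring.
  lra.
Qed.

(** From y^2 <= C D and eps |y| <= eps^2 + y^2 one gets a bound linear in the squared distance D;
    summing the constants over k and l makes it uniform. *)
Lemma vanish_bound_all z (e : 'I_n -> 'I_n -> {mpoly R[n]}) (eps : R) :
  0 < eps -> (forall k l, (e k l).@[z] = 0) -> exists2 C : R, 0 < C &
  forall k l x, K x -> `|(e k l).@[x]| <= eps + C * (dist2 z).@[x].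
Proof.
move=> eps0 e0.
have [C C0 hC] := fin_all_exists2 (fun kl : 'I_n * 'I_n => vanish_bound (e0 kl.1 kl.2)).
exists (\sum_kl C kl / eps + 1) => [|k l x Kx].
  by rewrite ltr_wpDl // sumr_ge0 // => kl _; rewrite divr_ge0 // ltW.
have := hC (k, l) x Kx => /= h.
have D0 := dist2_ge0 z x.
have Cs : C (k, l) / eps <= \sum_kl C kl / eps.
  rewrite (bigD1 (k, l)) //= lerDl sumr_ge0 // => kl _; rewrite divr_ge0 // ltW //.
apply: le_trans (_ : eps + C (k, l) / eps * (dist2 z).@[x] <= _); last first.
  by rewrite lerD2l ler_wpM2r // (le_trans Cs) // lerDl.
have -> : eps + C (k, l) / eps * (dist2 z).@[x] =
          (eps ^+ 2 + C (k, l) * (dist2 z).@[x]) / eps by field; lra.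
rewrite ler_pdivlMr //; apply: le_trans (_ : eps ^+ 2 + (e k l).@[x] ^+ 2 <= _);
  last by rewrite lerD2l.
rewrite -[(e k l).@[x] ^+ 2]real_normK ?num_real //.
set y := `|_|; have := sqr_ge0 (y - eps); have := sqr_ge0 y; have := sqr_ge0 eps; nra.
Qed.

Lemma shiftX_mul_bound z k l x : `|(x k - z k) * (x l - z l)| <= (dist2 z).@[x].
Proof.
have := dist2_coord z x k; have := dist2_coord z x l.
set a := _ - _; set b := _ - _; set D := meval _ _ => h1 h2.
rewrite ler_norml; have := sqr_ge0 (a - b); have := sqr_ge0 (a + b); nra.
Qed.

Lemma ideal_cube_bound z p (eps : R) : 0 < eps -> ideal_cube z p ->
  exists2 C : R, 0 < C & forall x, K x ->
    `|p.@[x]| <= (eps + C * (dist2 z).@[x]) * (dist2 z).@[x].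
Proof.
move=> eps0 [e e0 ->].
(* The + 1 keeps the divisor positive when n = 0. *)
pose N : R := (n * n)%:R + 1.
have N0 : 0 < N by rewrite ltr_wpDl.
have [C C0 h] := vanish_bound_all (divr_gt0 eps0 N0) e0.
exists (C * N) => [|x Kx]; first exact: mulr_gt0.
have D0 := dist2_ge0 z x; set D := (dist2 z).@[x] in D0 *.
rewrite raddf_sum /=; apply: le_trans (ler_norm_sum _ _ _) _.
apply: (@le_trans _ _ (\sum_(k < n) \sum_(l < n) ((eps / N + C * D) * D))).
  apply: ler_sum => k _; rewrite raddf_sum /=; apply: le_trans (ler_norm_sum _ _ _) _.
  apply: ler_sum => l _; rewrite !mevalM !shiftXE normrM mulrC.
  by apply: ler_pM => //; [exact: h|exact: shiftX_mul_bound].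
rewrite !sumr_const !card_ord -mulrnA -[X in X <= _]mulr_natl.
have -> : (eps + C * N * D) * D = N * ((eps / N + C * D) * D) by field; lra.
apply: ler_wpM2r; last by rewrite /N lerDl.
by rewrite mulr_ge0 // addr_ge0 // ?divr_ge0 ?mulr_ge0 // ltW.
Qed.

Lemma locally_pos_lower z F : locally_pos M z F -> exists rho c : R,
  [/\ 0 < rho, 0 < c & forall x, K x -> (dist2 z).@[x] <= rho ->
        c * (dist2 z).@[x] <= F.@[x]].
Proof.
move=> [d [m [p [d0 Mm pz ->]]]].
have [C C0 h] := ideal_cube_bound (divr_gt0 d0 (@ltr0Sn R 3)) pz.
(* With eps = d / 4 and C D <= d / 4, the third-order term costs at most half of d D. *)
exists (d / 4 / C), (d / 2); split; [by rewrite !divr_gt0|by rewrite divr_gt0|].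
move=> x Kx; rewrite ler_pdivlMr // => Dle.
have D0 := dist2_ge0 z x.
rewrite !mevalD mevalZ; have := Kx _ Mm; have := h _ Kx; rewrite ler_norml.
move=> /andP[h1 _]; set D := (dist2 z).@[x] in Dle D0 h1 *.
have : (d / 4 + C * D) * D <= (d / 4 + d / 4) * D.
  by apply: ler_wpM2r => //; rewrite lerD2l mulrC.
lra.
Qed.

End Bounds.

(** The induction varies M: adjoining [dist2 z - rho] removes a ball around z and keeps the module
    archimedean. Outside the ball the remaining zeros give the bound, up to the maximum of
    [dist2 z]; inside it the local bound at z does, up to the maximum of the other factors. *)
Lemma global_lower M (Z : seq {ffun 'I_n -> R}) F :
  qmodule M -> archimedean M ->
  (forall z : {ffun 'I_n -> R}, z \in Z -> exists rho c : R,
     [/\ 0 < rho, 0 < c & forall x, nonneg_locus M x -> (dist2 z).@[x] <= rho ->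
        c * (dist2 z).@[x] <= F.@[x]]) ->
  (forall x, nonneg_locus M x -> (forall z : {ffun 'I_n -> R}, z \in Z ->
    0 < (dist2 z).@[x]) ->
     0 < F.@[x]) ->
  exists2 kap : R, 0 < kap & forall x, nonneg_locus M x ->
    kap * \prod_(z <- Z) (dist2 z).@[x] <= F.@[x].
Proof.
elim: Z M => [|z Z IH] M qM aM locF F0.
  have [|c c0 h] := @pos_lower_bound _ _ _ F qM aM.
    by move=> x Kx; exact: F0.
  by exists c => // x Kx; rewrite big_nil mulr1; exact: h.
have [rho [c [rho0 c0 hloc]]] := locF z (mem_head _ _).
pose q := dist2 z - rho%:MP.
have Kq x : nonneg_locus (qm_adjoin M q) x <-> nonneg_locus M x /\ rho <= (dist2 z).@[x].
  by rewrite nonneg_locus_adjoin // mevalB mevalC subr_ge0.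
have [| |kap kap0 h] := IH _ (qmodule_adjoin q qM) (archimedean_adjoin q aM).
- move=> y yZ; have [|r [c' [r0 c'0 hy]]] := locF y; first by rewrite inE yZ orbT.
  by exists r, c'; split=> // x /Kq[Kx _]; exact: hy.
- move=> x /Kq[Kx rx] xZ; apply: F0 => // y; rewrite inE => /predU1P[->|/xZ //].
  exact: lt_le_trans rx.
have [A A0 [_ hA]] := archimedean_ub qM aM (dist2 z).
have [B B0 [_ hB]] := archimedean_ub qM aM (\prod_(y <- Z) dist2 y).
exists (Num.min (kap / A) (c / B)) => [|x Kx].
  by rewrite lt_min !divr_gt0.
rewrite big_cons.
have P0 : 0 <= \prod_(y <- Z) (dist2 y).@[x].
  by apply: prodr_ge0 => y _; exact: dist2_ge0.
have D0 := dist2_ge0 z x.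
have DA := le_trans (ler_norm _) (hA _ Kx).
have PB : \prod_(y <- Z) (dist2 y).@[x] <= B.
  by have := le_trans (ler_norm _) (hB _ Kx); rewrite rmorph_prod.
have [Dr|Dr] := leP rho (dist2 z).@[x].
  apply: le_trans (h x _); last by apply/Kq.
  apply: (@le_trans _ _ (kap / A * (A * \prod_(y <- Z) (dist2 y).@[x]))).
    apply: ler_pM; [|exact: mulr_ge0| |exact: ler_wpM2r].
      by rewrite le_min !divr_ge0 ?ltW.
    by rewrite ge_min lexx.
  by rewrite mulrA divfK ?gt_eqF.
apply: le_trans (hloc x Kx (ltW Dr)).
apply: (@le_trans _ _ (c / B * (B * (dist2 z).@[x]))).
  apply: ler_pM; [|exact: mulr_ge0| |by rewrite mulrC ler_wpM2r].
    by rewrite le_min !divr_ge0 ?ltW.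
  by rewrite ge_min lexx orbT.
by rewrite mulrA divfK ?gt_eqF.
Qed.

End LocalStructure.

(** * Removal of the zeros *)

Section LocalGlobal.
Variables (R : realType) (n : nat).
Implicit Types (p q u F : {mpoly R[n]}) (M : {mpoly R[n]} -> Prop).
Implicit Types (z y : {ffun 'I_n -> R}) (Z : seq {ffun 'I_n -> R}).

(** Bernoulli's inequality turned into an upper bound: it makes y (1 - y)^k at most 1 / k, which is
    how b is seen to concentrate at z. *)
Lemma bernoulli_inv (y : R) k : 0 <= y <= 1 -> (1 - y) ^+ k * (1 + k%:R * y) <= 1.
Proof.
move=> /andP[y0 y1]; elim: k => [|k IH]; first by rewrite expr0 mul0r addr0 mulr1.
apply: le_trans IH; rewrite exprSr -mulrA ler_wpM2l ?exprn_ge0 ?subr_ge0 //.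
rewrite -natr1; have : 0 <= k%:R :> R by []; nra.
Qed.

Let cong1 (a p : {mpoly R[n]}) := exists v, 1 - p = a * v.

Let cong1_1 a : cong1 a 1.
Proof. by exists 0; rewrite subrr mulr0. Qed.

Let cong1M a p q : cong1 a p -> cong1 a q -> cong1 a (p * q).
Proof.
move=> [v pv] [w qw]; exists (v + p * w).
have -> : 1 - p * q = (1 - p) + p * (1 - q) by ring.
by rewrite pv qw; ring.
Qed.

Let cong1X a p k : cong1 a p -> cong1 a (p ^+ k).
Proof.
move=> h; elim: k => [|k IH]; first by rewrite expr0; exact: cong1_1.
by rewrite exprS; exact: cong1M.
Qed.

Let cong1_lin a (c : R) : cong1 a (1 - c *: a).
Proof. by exists c%:MP; rewrite -mul_mpolyC; ring. Qed.

(* Equals 1 at z and vanishes to fourth order at the points of Z. *)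
Let screen (z : {ffun 'I_n -> R}) (Z : seq {ffun 'I_n -> R}) : {mpoly R[n]} :=
  \prod_(y <- Z) (1 - ((dist2 z).@[y])^-1 *: dist2 z) ^+ 4.

Let screen_cong z Z : cong1 (dist2 z) (screen z Z).
Proof.
apply: (big_ind (cong1 (dist2 z))); [exact: cong1_1|exact: cong1M|move=> y _].
exact/cong1X/cong1_lin.
Qed.

Let screen_sos z Z : sos (screen z Z).
Proof.
apply: (big_ind (@sos R n)); [|by move=> p q; exact: sosM|move=> y _].
  by rewrite -(expr1n _ 2); exact: sos_sqr.
by rewrite (exprM _ 2 2); exact: sos_sqr.
Qed.

Let dist2_neq0 (z y : {ffun 'I_n -> R}) : z != y -> (dist2 z).@[y] != 0.
Proof.
by apply: contraNneq => /dist2_eq0 h; apply/eqP/ffunP => k; rewrite h.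
Qed.

Let factor0 (z y : {ffun 'I_n -> R}) : z != y ->
  (1 - ((dist2 z).@[y])^-1 *: dist2 z).@[y] = 0.
Proof.
by move=> zy; rewrite mevalB mevalZ meval1 mulVf ?subrr // dist2_neq0.
Qed.

(** The exponent 4 is even, for a sum of squares, and at least 3, to reach the cube of the ideal of
    y. *)
Let screen_cube (z y : {ffun 'I_n -> R}) Z : z != y -> y \in Z ->
  ideal_cube y (screen z Z).
Proof.
move=> zy yZ; rewrite /screen (big_rem y) //= mulrC; apply: ideal_cube_mull.
set f := _ - _; have f0 : f.@[y] = 0 by exact: factor0.
rewrite (exprD _ 2 2); apply: ideal_cubeM; first exact: ideal_sqrM.
by rewrite rmorphXn /= f0 expr0n.
Qed.

(** Trades the product of distances in [global_lower] for the screen. Of the four factors at y, two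
    are absorbed by [dist2 y] and two by a constant. *)
Let screen_bound M (z : {ffun 'I_n -> R}) Z : qmodule M -> archimedean M ->
  z \notin Z -> exists2 C : R, 0 < C &
  forall x, nonneg_locus M x ->
    (screen z Z).@[x] <= C * \prod_(y <- Z) (dist2 y).@[x].
Proof.
move=> qM aM; elim: Z => [|y Z IH].
  by exists 1 => // x _; rewrite /screen !big_nil meval1 mulr1.
rewrite inE negb_or => /andP[zy /IH[C C0 hC]].
set f := 1 - ((dist2 z).@[y])^-1 *: dist2 z.
have [B B0 hB] := vanish_bound qM aM (factor0 zy).
have [N N0 [_ hN]] := archimedean_ub qM aM (f ^+ 2).
exists (B * N * C) => [|x Kx]; first by rewrite !mulr_gt0.
rewrite /screen !big_cons -/(screen z Z) mevalM -/f.
have -> : B * N * C * ((dist2 y).@[x] * \prod_(j <- Z) (dist2 j).@[x]) =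
  (B * (dist2 y).@[x]) * N * (C * \prod_(j <- Z) (dist2 j).@[x]) by ring.
rewrite (exprD _ 2 2) mevalM.
apply: ler_pM; [|exact: sos_ge0| |exact: hC].
  by rewrite rmorphXn -expr2 sqr_ge0.
apply: ler_pM; rewrite ?rmorphXn ?sqr_ge0 //; first exact: hB.
by have := le_trans (ler_norm _) (hN x Kx); rewrite rmorphXn.
Qed.

Let screen_self z Z : (screen z Z).@[z] = 1.
Proof.
rewrite rmorph_prod big1 // => y _; rewrite rmorphXn /= mevalB mevalZ dist2_self.
by rewrite mulr0 subr0 meval1 expr1n.
Qed.

(* Let b = (1 - |x-z|^2/A)^k with k large and even, so that b is concentrated at z, and
   let s be the screen.  In s b F = s b (d |x-z|^2 + m + sum (x-z)_i (x-z)_j e_ij) the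
   last sum becomes, by polarisation, a combination of squares with coefficients
   eps +- b e_ij, which are positive on the whole set once eps n |x-z|^2 is subtracted;
   and 1 - s b is a multiple v |x-z|^2. *)
Lemma remove_zero M (z : {ffun 'I_n -> R}) (Z : seq {ffun 'I_n -> R}) F :
  qmodule M -> archimedean M -> z \notin Z ->
  (forall y, y \in z :: Z ->
     [/\ nonneg_locus M y, F.@[y] = 0 & locally_pos M y F]) ->
  (forall x, nonneg_locus M x -> (forall y : {ffun 'I_n -> R}, y \in z :: Z ->
     0 < (dist2 y).@[x]) -> 0 < F.@[x]) ->
  exists m F1, [/\ M m, F = m + dist2 z * F1,
    forall y, y \in Z ->
     [/\ nonneg_locus M y, F1.@[y] = 0 & locally_pos M y F1] &
    forall x, nonneg_locus M x -> (forall y : {ffun 'I_n -> R}, y \in Z ->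
     0 < (dist2 y).@[x]) -> 0 < F1.@[x]].
Proof.
move=> qM aM zZ locF F0; set a := dist2 z.
have [kap0 kap00 hkap0] : exists2 kap : R, 0 < kap & forall x, nonneg_locus M x ->
    kap * \prod_(y <- z :: Z) (dist2 y).@[x] <= F.@[x].
  apply: global_lower => // y /locF[_ _]; exact: locally_pos_lower.
have [Kz Fz [d [m [p [d0 Mm [e e0 pE] FE]]]]] := locF z (mem_head _ _).
pose s := screen z Z.
have s_ge0 x : 0 <= s.@[x] by apply/sos_ge0/screen_sos.
have [C C0 hC] := screen_bound qM aM zZ.
have [S S0 [_ hS]] := archimedean_ub qM aM s.
have sS x : nonneg_locus M x -> s.@[x] <= S.
  by move=> Kx; apply: le_trans (ler_norm _) (hS _ Kx).
have S1 : 1 <= S by rewrite -(screen_self z Z); exact: sS.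
(* The first bound gives F >= kap s a, the second gives kap s <= d on the whole set. *)
pose kap := Num.min (kap0 / C) (d / S).
have kap_gt0 : 0 < kap by rewrite lt_min !divr_gt0.
have kapS : kap * S <= d by rewrite -ler_pdivlMr // /kap ge_min lexx orbT.
have kapd : kap <= d by apply: le_trans kapS; rewrite ler_peMr // ltW.
have a_ge0 x : 0 <= a.@[x] by exact: dist2_ge0.
have Flow x : nonneg_locus M x -> kap * (s.@[x] * a.@[x]) <= F.@[x].
  move=> Kx; apply: le_trans (hkap0 _ Kx); rewrite big_cons.
  set P := \prod_(y <- Z) _.
  apply: (@le_trans _ _ (kap0 / C * (C * P * a.@[x]))).
    apply: ler_pM; [exact: ltW|exact: mulr_ge0|by rewrite ge_min lexx|].
    by apply: ler_wpM2r => //; exact: hC.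
  by rewrite -!mulrA mulKf ?gt_eqF // [P * _]mulrC.
pose nn : R := n%:R.
have nn0 : 0 <= nn by rewrite /nn.
pose eps := kap / (2 * (nn + 1)).
have eps0 : 0 < eps by rewrite divr_gt0 // mulr_gt0 // ltr_wpDl.
have epsn : eps * nn <= kap / 2.
  rewrite /eps mulrAC ler_pdivrMr ?mulr_gt0 ?ltr_wpDl //.
  have -> : kap / 2 * (2 * (nn + 1)) = kap * nn + kap by field.
  by rewrite lerDl ltW.
have [A A0 [_ hA]] := archimedean_ub qM aM a.
have aA x : nonneg_locus M x -> a.@[x] <= A.
  by move=> Kx; apply: le_trans (ler_norm _) (hA _ Kx).
have [vs vsE] := screen_cong z Z; rewrite -/s -/a in vsE.
have [Cv Cv0 [_ hCv]] := archimedean_ub qM aM vs.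
have eps2 : 0 < eps / 2 by lra.
have [C1 C10 hC1] := vanish_bound_all qM aM eps2 e0.
have t10 : 0 <= 2 * C1 * A / eps.
  by rewrite ltW // divr_gt0 // !mulr_gt0.
have t20 : 0 <= Cv * A by rewrite mulr_ge0 ?(ltW Cv0) ?(ltW A0).
(* The first threshold serves [be], the second [sb_le1]. The exponent k is twice N so that b is a
   sum of squares. *)
pose N := Num.bound (2 * C1 * A / eps + Cv * A).
have hN : 2 * C1 * A / eps + Cv * A < N%:R.
  by apply: archi_boundP; exact: addr_ge0.
pose k := (2 * N)%N.
have kN : N%:R <= k%:R :> R by rewrite ler_nat /k mul2n -addnn leq_addl.
have k1 : 2 * C1 * A / eps < k%:R by apply: lt_le_trans kN; lra.
have k2 : Cv * A < k%:R by apply: lt_le_trans kN; lra.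
have k0 : 0 < k%:R :> R by apply: le_lt_trans k2.
pose t := 1 - A^-1 *: a.
pose b := t ^+ k.
have sos_b : sos b by rewrite /b /k exprM; apply/sos_exp/sos_sqr.
have tE x : t.@[x] = 1 - a.@[x] / A by rewrite mevalB mevalZ meval1 mulrC.
have b_ge0 x : 0 <= b.@[x] by exact: sos_ge0.
have bb x : nonneg_locus M x -> b.@[x] * (1 + k%:R * (a.@[x] / A)) <= 1.
  move=> Kx; rewrite rmorphXn /= tE; apply: bernoulli_inv.
  by rewrite divr_ge0 ?(ltW A0) // ler_pdivrMr // mul1r aA.
have [v vE] : cong1 a (s * b).
  by apply: cong1M; [exact: screen_cong|exact/cong1X/cong1_lin].
(* From k >= Cv A one gets s = 1 - a vs <= 1 + k a / A, and the Bernoulli bound on b absorbs this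
   factor. *)
have sb_le1 x : nonneg_locus M x -> s.@[x] * b.@[x] <= 1.
  move=> Kx; apply: le_trans (bb _ Kx); rewrite mulrC ler_wpM2l //.
  have sE : s.@[x] = 1 - a.@[x] * vs.@[x].
    by rewrite -mevalM -vsE mevalB meval1 subKr.
  rewrite sE lerD2l mulrCA -mulrN ler_wpM2l //.
  rewrite ler_pdivlMr //; apply: le_trans (ltW k2); rewrite ler_wpM2r ?(ltW A0) //.
  by apply: le_trans (ler_norm _) _; rewrite normrN hCv.
have be x i j : nonneg_locus M x -> b.@[x] * `|(e i j).@[x]| < eps.
  move=> Kx; apply: (@le_lt_trans _ _ (b.@[x] * (eps / 2 + C1 * a.@[x]))).
    by apply: ler_wpM2l => //; exact: hC1.
  have b1 : b.@[x] <= 1.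
    apply: le_trans (bb _ Kx); rewrite ler_peMr // lerDl.
    by rewrite mulr_ge0 ?divr_ge0 ?(ltW A0) ?(ltW k0).
  have ba : b.@[x] * a.@[x] <= A / k%:R.
    rewrite ler_pdivlMr // -[A]mul1r -ler_pdivrMr //.
    apply: le_trans (bb _ Kx); rewrite mulrDr mulr1 -lerBlDr.
    have -> : b.@[x] * a.@[x] * k%:R / A = b.@[x] * (k%:R * (a.@[x] / A)) by field; lra.
    by rewrite subrr.
  have c1 : C1 * (b.@[x] * a.@[x]) < eps / 2.
    apply: (@le_lt_trans _ _ (C1 * (A / k%:R))); first by rewrite ler_pM2l.
    rewrite mulrA ltr_pdivrMr //.
    by move: k1; rewrite ltr_pdivrMr //; lra.
  have b2 : b.@[x] * (eps / 2) <= 1 * (eps / 2) by apply: ler_wpM2r => //; exact: ltW.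
  lra.
pose dk i j := shiftX z i + shiftX z j.
pose dm i j := shiftX z i - shiftX z j.
pose m' := s * (b * m) + s * \sum_i \sum_j 4^-1 *:
  (dk i j ^+ 2 * (eps%:MP + b * e i j) + dm i j ^+ 2 * (eps%:MP - b * e i j)).
(* In F = (1 - s b) F + s b F the first summand is a v F; the second, less m', is s a (d b - eps n).
   [F1] is the common cofactor of a. *)
pose F1 := v * F + s * (d *: b - (eps * nn)%:MP).
have Mm' : M m'.
  apply: (qmD qM); first by apply: (qm_sosM qM (screen_sos _ _)); exact: (qm_sosM qM).
  apply: (qm_sosM qM); first exact: screen_sos.
  apply: (qm_sum qM) => i _; apply: (qm_sum qM) => j _; apply: (qmZ qM); first by lra.
  apply: (qmD qM); apply: (qm_sqrM qM); apply: putinar => // x Kx;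
    rewrite ?mevalB ?mevalD mevalC mevalM; have := be x i j Kx;
    have := ler_norm (e i j).@[x]; have := ler_norm (- (e i j).@[x]);
    rewrite normrN; have := b_ge0 x; nra.
have quadE : \sum_i \sum_j 4^-1 *:
  (dk i j ^+ 2 * (eps%:MP + b * e i j) + dm i j ^+ 2 * (eps%:MP - b * e i j))
   = (eps * nn) *: a + b * p.
  transitivity (\sum_i \sum_j ((eps / 2) *: (shiftX z i ^+ 2 + shiftX z j ^+ 2)
       + b * (shiftX z i * shiftX z j * e i j))).
    apply: eq_bigr => i _; apply: eq_bigr => j _.
    transitivity (4^-1 *: (4%:R *: ((eps / 2) *: (shiftX z i ^+ 2 + shiftX z j ^+ 2)
       + b * (shiftX z i * shiftX z j * e i j)))); last first.
      by rewrite scalerA mulVf ?scale1r //; lra.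
    congr (_ *: _); rewrite /dk /dm scalerDr scalerA.
    have -> : 4 * (eps / 2) = 2 * eps by field.
    rewrite -!mul_mpolyC; ring.
  transitivity (\sum_i \sum_j (eps / 2) *: (shiftX z i ^+ 2 + shiftX z j ^+ 2)
      + b * p).
    rewrite pE mulr_sumr -big_split; apply: eq_bigr => i _ /=.
    by rewrite mulr_sumr -big_split.
  congr (_ + _);
    transitivity (\sum_(i < n) ((eps / 2) *: a + (eps / 2 * nn) *: shiftX z i ^+ 2)).
    apply: eq_bigr => i _; rewrite -scaler_sumr big_split /= sumr_const card_ord.
    by rewrite scalerDr -/a addrC -scaler_nat scalerA.
  rewrite big_split /= sumr_const card_ord -scaler_sumr -/a -scaler_nat scalerA -scalerDl.
  by congr (_ *: _); rewrite -/nn; field.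
have FE1 : F = m' + a * F1.
  rewrite /m' /F1 quadE.
  transitivity ((1 - s * b) * F + s * b * F); first by ring.
  rewrite vE {2}FE -!mul_mpolyC -/a mpolyCM; ring.
(* The screen vanishes at y, so 1 = a v there. *)
have vT (y : {ffun 'I_n -> R}) : y \in Z -> 0 < v.@[y].
  move=> yZ; have zy : z != y by apply: contraNneq zZ => ->.
  have sy : s.@[y] = 0 by apply/ideal_sqr_eval/ideal_cube_sqr/screen_cube.
  have := congr1 (fun q => q.@[y]) vE; rewrite mevalB !mevalM meval1 sy mul0r subr0 => h.
  have ay : 0 < a.@[y] by rewrite lt0r dist2_neq0 // a_ge0.
  by rewrite -(pmulr_rgt0 _ ay) -h.
exists m', F1; split; [exact: Mm'|exact: FE1|move=> y yZ|move=> x Kx hx].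
  have zy : z != y by apply: contraNneq zZ => ->.
  have [|Ky Fy locy] := locF y; first by rewrite inE yZ orbT.
  have scube := screen_cube zy yZ.
  split=> //.
    rewrite mevalD !mevalM Fy mulr0 add0r -/s.
    by rewrite (ideal_sqr_eval (ideal_cube_sqr scube)) mul0r.
  apply: locally_posD_cube; last by rewrite mulrC; exact: ideal_cube_mull.
  by apply: locally_pos_mul => //; exact: vT.
have [ax|] := ltrP 0 a.@[x]; last first.
  move=> ax; have /dist2_eq0 xz : a.@[x] = 0 by apply/eqP; rewrite eq_le ax a_ge0.
  rewrite (meval_eq F1 xz) mevalD !mevalM Fz mulr0 add0r screen_self mul1r.
  rewrite mevalB mevalZ mevalC rmorphXn /= tE dist2_self mul0r subr0 expr1n; lra.
have Fx : 0 < F.@[x].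
  by apply: F0 => // y; rewrite inE => /predU1P[->|/hx].
rewrite -(pmulr_rgt0 _ ax) -mevalM.
have -> : a * F1 = (1 - s * b) * F + s * a * (d *: b - (eps * nn)%:MP).
  by rewrite vE /F1; ring.
rewrite mevalD !mevalM !mevalB mevalZ mevalM meval1 mevalC.
have := sb_le1 _ Kx; have := Flow _ Kx; have := sS _ Kx.
have := s_ge0 x; have := b_ge0 x.
set sx := s.@[x]; set bx := b.@[x]; set Fv := F.@[x] in Fx *; set av := a.@[x] in ax *.
move=> bx0 sx0 sxS Fl sb1.
have [sx_gt0|] := ltrP 0 sx; last first.
  by move=> sx_le; have -> : sx = 0 by [lra]; rewrite !mul0r subr0 mul1r addr0.
(* Replacing F by its lower bound kap s a leaves s a times a bracket that is at least kap / 2,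
   because kap s b <= d b and eps n <= kap / 2. *)
apply: (@lt_le_trans _ _ ((1 - sx * bx) * (kap * (sx * av)) +
  sx * av * (d * bx - eps * nn))).
  have -> : (1 - sx * bx) * (kap * (sx * av)) + sx * av * (d * bx - eps * nn) =
     sx * av * (kap - kap * sx * bx + d * bx - eps * nn) by ring.
  rewrite mulr_gt0 ?mulr_gt0 //.
  have : kap * sx * bx <= d * bx.
    apply: ler_wpM2r => //; apply: le_trans kapS.
    by rewrite ler_wpM2l // ltW.
  lra.
by rewrite lerD2r ler_wpM2l // subr_ge0.
Qed.

Theorem local_global M (Z : seq {ffun 'I_n -> R}) F :
  qmodule M -> archimedean M -> uniq Z ->
  (forall y, y \in Z ->
     [/\ nonneg_locus M y, F.@[y] = 0 & locally_pos M y F]) ->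
  (forall x, nonneg_locus M x -> (forall y : {ffun 'I_n -> R}, y \in Z ->
     0 < (dist2 y).@[x]) -> 0 < F.@[x]) -> M F.
Proof.
move=> qM aM; elim: Z F => [|z Z IH] F /=.
  by move=> _ _ F0; apply: putinar => // x Kx; exact: F0.
case/andP=> zZ uZ locF F0.
have [m [F1 [Mm -> loc1 F10]]] := remove_zero qM aM zZ locF F0.
by apply: (qmD qM) => //; apply: (qm_sosM qM); [exact: sos_dist2|exact: IH].
Qed.

End LocalGlobal.

(** * Stable sets and the standard quadratic program *)

Section Simplex.
Variables (R : realType) (n : nat).
Implicit Types (p q u : {mpoly R[n]}).

Definition simplex (x : 'I_n -> R) : Prop :=
  (forall i, 0 <= x i) /\ \sum_i x i = 1.

Definition simplex_eqn : {mpoly R[n]} := \sum_(i < n) 'X_i - 1.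

Definition simplex_qm p : Prop :=
  exists (s0 : {mpoly R[n]}) (s : 'I_n -> {mpoly R[n]}) (u : {mpoly R[n]}),
    [/\ sos s0, forall j, sos (s j) &
        p = s0 + \sum_(j < n) s j * 'X_j + u * simplex_eqn].

Lemma simplex_qmodule : qmodule simplex_qm.
Proof.
split.
- exists (1 ^+ 2), (fun=> 0), 0; split=> [|j|]; [exact: sos_sqr|exact: sos0|].
  by rewrite big1 ?expr1n ?mul0r ?addr0 // => j _; rewrite mul0r.
- move=> p q [s0 [s [u [s00 sj ->]]]] [t0 [t [v [t00 tj ->]]]].
  exists (s0 + t0), (fun j => s j + t j), (u + v).
  split=> [|j|]; [exact: sos_add|exact: sos_add|].
  under [in RHS]eq_bigr do rewrite mulrDl.
  by rewrite big_split /=; ring.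
- move=> p q [s0 [s [u [s00 sj ->]]]].
  exists (q ^+ 2 * s0), (fun j => q ^+ 2 * s j), (q ^+ 2 * u).
  split=> [|j|]; [exact: sos_sqrM|exact: sos_sqrM|].
  rewrite 2!mulrDr mulr_sumr; congr (_ + _ + _); last by rewrite mulrA.
  by apply: eq_bigr => j _; rewrite mulrA.
Qed.

Lemma simplex_qm_coord i : simplex_qm 'X_i.
Proof.
exists 0, (fun j => ((j == i)%:R) ^+ 2), 0; split=> [|j|]; [exact: sos0|exact: sos_sqr|].
rewrite mul0r addr0 add0r (bigD1 i) //= eqxx expr1n mul1r big1 ?addr0 //.
by move=> j /negPf ->; rewrite expr0n mul0r.
Qed.

Lemma simplex_qm_ideal u : simplex_qm (u * simplex_eqn).
Proof.
exists 0, (fun=> 0), u; split=> [|j|]; [exact: sos0|exact: sos0|].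
by rewrite big1 ?add0r // => j _; rewrite mul0r.
Qed.

(** Modulo the equation of the simplex, 1 - X_i is the sum of the other variables. *)
Lemma simplex_archimedean : archimedean simplex_qm.
Proof.
have qS := simplex_qmodule.
apply: (archimedean_gen qS) => i; exists 1 => //; split; last first.
  by apply: (qmD qS); [exact: (qmC qS)|exact: simplex_qm_coord].
have -> : (1 : R)%:MP - 'X_i = \sum_(j < n | j != i) 'X_j + -1 * simplex_eqn.
  by rewrite /simplex_eqn [in RHS](bigD1 i (P := xpredT)) //= mpolyC1; ring.
apply: (qmD qS); last exact: simplex_qm_ideal.
by apply: (qm_sum qS) => j _; exact: simplex_qm_coord.
Qed.

Lemma simplex_eqnE x : simplex_eqn.@[x] = \sum_i x i - 1.
Proof.
rewrite mevalB meval1 raddf_sum /=; congr (_ - _).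
by apply: eq_bigr => i _; rewrite mevalXU.
Qed.

Lemma simplex_qm_ge0 p x : simplex_qm p -> simplex x -> 0 <= p.@[x].
Proof.
move=> [s0 [s [u [s00 sj ->]]]] [x0 x1].
rewrite !mevalD mevalM simplex_eqnE x1 subrr mulr0 addr0 raddf_sum.
apply: addr_ge0; first exact: sos_ge0.
apply: sumr_ge0 => j _ /=; rewrite mevalM mevalXU mulr_ge0 //; exact: sos_ge0.
Qed.

Lemma simplex_locus x : nonneg_locus simplex_qm x <-> simplex x.
Proof.
split=> [K|S p Mp]; last exact: simplex_qm_ge0 S.
split=> [i|]; first by rewrite -mevalXU; apply: K; exact: simplex_qm_coord.
apply/eqP; rewrite -subr_eq0 -simplex_eqnE eq_le -oppr_ge0 -mevalN.
by apply/andP; split; apply: K;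
  [rewrite -mulN1r|rewrite -[simplex_eqn]mul1r]; exact: simplex_qm_ideal.
Qed.

End Simplex.

Section QuadraticForms.
Variables (R : realType) (n : nat) (B : 'M[R]_n).

Definition qval (x : 'I_n -> R) : R := \sum_i \sum_j B i j * (x i * x j).

Lemma qformE (x : 'I_n -> R) : (qform B).@[x] = qval x.
Proof.
rewrite raddf_sum; apply: eq_bigr => i _; rewrite raddf_sum; apply: eq_bigr => j _.
by rewrite /= mevalZ mevalM !mevalXU.
Qed.

Lemma qval_line x d t : qval (fun k => x k + t * d k) =
  qval x + t * (\sum_i \sum_j B i j * (x i * d j + d i * x j)) + t ^+ 2 * qval d.
Proof.
rewrite /qval !mulr_sumr -!big_split; apply: eq_bigr => i _ /=.
rewrite !mulr_sumr -!big_split; apply: eq_bigr => j _ /=; ring.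
Qed.

Lemma sum_delta2 (f : 'I_n -> R) i j :
  \sum_k ((k == i)%:R - (k == j)%:R) * f k = f i - f j.
Proof.
under eq_bigr do rewrite mulrBl.
rewrite sumrB (bigD1 i) //= eqxx mul1r big1; last by move=> k /negPf ->; rewrite mul0r.
rewrite (bigD1 j) //= eqxx mul1r big1; last by move=> k /negPf ->; rewrite mul0r.
by rewrite !addr0.
Qed.

Lemma qval_edge i j : B j i = B i j ->
  qval (fun k => (k == i)%:R - (k == j)%:R) = B i i + B j j - 2 * B i j.
Proof.
move=> Bs; rewrite /qval.
transitivity (\sum_k ((k == i)%:R - (k == j)%:R) * (B k i - B k j)).
  apply: eq_bigr => k _; rewrite -(sum_delta2 (B k)) mulr_sumr.
  by apply: eq_bigr => l _; ring.
rewrite sum_delta2 Bs; ring.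
Qed.

End QuadraticForms.

(** * Minimisers and w-maximum stable sets *)

Section StableSets.
Variables (R : realType) (n : nat) (e : rel 'I_n) (w : 'I_n -> R).
Hypotheses (n_gt0 : (0 < n)%N) (e_sym : symmetric e) (e_irr : irreflexive e)
  (w_gt0 : forall i, 0 < w i).

Lemma stableP (S : {set 'I_n}) :
  reflect (forall i j, i \in S -> j \in S -> ~~ e i j) (stable e S).
Proof.
apply: (iffP 'forall_implyP) => [h i j iS jS|h i iS].
  by have /forall_inP := h i iS; apply.
by apply/forall_inP => j jS; exact: h.
Qed.

Lemma weight_le_alpha (S : {set 'I_n}) : stable e S -> weight w S <= alpha e w.
Proof. by move=> sS; rewrite /alpha (bigD1 S) //= le_max lexx. Qed.

Lemma alpha_attained : exists S : {set 'I_n}, wmaximum e w S.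
Proof.
suff [S sS wS] : exists2 S : {set 'I_n}, stable e S & weight w S = alpha e w.
  by exists S; rewrite /wmaximum sS wS eqxx.
apply: (big_ind (fun v => exists2 S : {set 'I_n}, stable e S & weight w S = v)).
- exists set0; last by rewrite /weight big_set0.
  by apply/stableP => i j; rewrite inE.
- by move=> x y [S sS <-] [T sT <-]; case: leP => _; [exists T|exists S].
- by move=> S sS; exists S.
Qed.

Lemma alpha_gt0 : 0 < alpha e w.
Proof.
case: n n_gt0 e w e_irr w_gt0 => // m _ e' w' irr w'0.
apply: (@lt_le_trans _ _ (weight w' [set ord0])); first by rewrite /weight big_set1.
rewrite /alpha (bigD1 [set ord0]) /= ?le_max ?lexx //.
by apply/forall_inP => i /set1P ->; apply/forall_inP => j /set1P ->; rewrite irr.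
Qed.

Let alpha0 := alpha_gt0.

(* The minimiser supported by S. *)
Definition wpoint (S : {set 'I_n}) : {ffun 'I_n -> R} :=
  [ffun i => if i \in S then w i / alpha e w else 0].

Lemma wpoint_neq0 S i : (wpoint S i != 0) = (i \in S).
Proof.
by rewrite ffunE; case: ifP; rewrite ?eqxx // => _; rewrite gt_eqF // divr_gt0.
Qed.

Lemma sum_wpoint S (f : 'I_n -> R) :
  \sum_i f i * wpoint S i = (\sum_(i in S) f i * w i) / alpha e w.
Proof.
rewrite mulr_suml [RHS]big_mkcond; apply: eq_bigr => i _.
by rewrite ffunE; case: ifP; rewrite ?mulr0 // mulrA.
Qed.

Lemma simplex_wpoint S : wmaximum e w S -> simplex (wpoint S).
Proof.
move=> /andP[_ /eqP wS]; split=> [i|].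
  by rewrite ffunE; case: ifP => // _; rewrite divr_ge0 // ltW.
have := sum_wpoint S (fun=> 1); under eq_bigr do rewrite mul1r.
by move=> ->; under eq_bigr do rewrite mul1r; rewrite -/(weight w S) wS divff ?gt_eqF.
Qed.

Section Matrix.
Variable B : 'M[R]_n.
Hypothesis HB : MGw e w B.
Let la := (alpha e w)^-1.

Let Bsym i j : B j i = B i j.
Proof. by case: HB => /matrixP/(_ i j); rewrite mxE. Qed.

Let Bdiag i : B i i = (w i)^-1.
Proof. by case: HB. Qed.

Let Bedge i j : e i j -> B i i + B j j <= 2 * B i j.
Proof. by move=> eij; case: HB => _ _ /(_ _ _ eij) h _; lra. Qed.

Let Bnon i j : i != j -> ~~ e i j -> B i j = 0.
Proof. by case: HB => _ _ _; apply. Qed.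

Lemma qval_stable (x : 'I_n -> R) (S : {set 'I_n}) :
  stable e S -> (forall i, (i \notin S) -> x i = 0) ->
  qval B x = \sum_i x i ^+ 2 / w i.
Proof.
move=> /stableP sS xS; apply: eq_bigr => i _.
rewrite (bigD1 i) //= big1 ?addr0 ?Bdiag; first by rewrite mulrC -expr2.
move=> j ji; have [iS|/xS ->] := boolP (i \in S); last by rewrite mul0r mulr0.
have [jS|/xS ->] := boolP (j \in S); last by rewrite !mulr0.
by rewrite Bnon ?mul0r ?sS // eq_sym.
Qed.

Lemma qval_wpoint S : wmaximum e w S -> qval B (wpoint S) = la.
Proof.
move=> /andP[sS /eqP wS].
rewrite (qval_stable sS); last by move=> i /negPf iS; rewrite ffunE iS.
transitivity (\sum_i (if i \in S then w i else 0) * la ^+ 2).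
  apply: eq_bigr => i _; rewrite ffunE; case: ifP => _; last by rewrite expr0n !mul0r.
  by rewrite /la; have := w_gt0 i => wi; field; rewrite !gt_eqF.
rewrite -mulr_suml -big_mkcond -/(weight w S) wS /la; field; by rewrite gt_eqF.
Qed.

Hypothesis Bcrit : forall i j, wcritical e w i j -> B i i + B j j < 2 * B i j.

(* Weighted Motzkin-Straus: along e_i - e_j for an edge ij inside the support, the
   form is concave, so it is minimised at the ends of the segment, where the support
   is smaller. *)
Lemma motzkin_straus (x : 'I_n -> R) : simplex x ->
  la <= qval B x /\ (qval B x = la -> exists2 S, wmaximum e w S & x =1 wpoint S).
Proof.
have [m] := ubnP #|[set i | x i != 0]|; elim: m x => // m IH x.
set S := [set i | x i != 0] => cS Sx; have [x0 x1] := Sx.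
have [sS|] := boolP (stable e S).
  have xS i : i \notin S -> x i = 0 by rewrite inE negbK => /eqP.
  (* On a stable support the form is diagonal. Completing squares around w_i / alpha leaves a
     constant that is at least 1 / alpha because w(S) <= alpha. *)
  have qE : qval B x =
      \sum_(i in S) (x i - w i * la) ^+ 2 / w i + (2 * la - weight w S * la ^+ 2).
    rewrite (qval_stable sS xS).
    transitivity (\sum_i ((if i \in S then (x i - w i * la) ^+ 2 / w i else 0)
       + (2 * la * x i - la ^+ 2 * (if i \in S then w i else 0)))).
      apply: eq_bigr => i _; case: ifP => [_|/negbT/xS ->];
        last by rewrite expr0n !mul0r !mulr0 subr0 addr0.
      by have := w_gt0 i => wi; field; rewrite gt_eqF.
    rewrite big_split /= -big_mkcond; congr (_ + _).
    by rewrite sumrB -!mulr_sumr x1 mulr1 -big_mkcond [weight w S * _]mulrC.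
  have wS := weight_le_alpha sS.
  have la0 : 0 < la by rewrite invr_gt0.
  have alE : alpha e w * la ^+ 2 = la by rewrite /la expr2 mulrA mulfV ?mul1r ?gt_eqF.
  have wl : weight w S * la ^+ 2 <= la by rewrite -[X in _ <= X]alE ler_wpM2r ?sqr_ge0.
  have t0 i : i \in S -> 0 <= (x i - w i * la) ^+ 2 / w i.
    by move=> _; rewrite divr_ge0 ?sqr_ge0 // ltW.
  have T0 : 0 <= \sum_(i in S) (x i - w i * la) ^+ 2 / w i by exact: sumr_ge0.
  split=> [|qx]; first by rewrite qE; lra.
  have Sum0 : \sum_(i in S) (x i - w i * la) ^+ 2 / w i = 0 by lra.
  have wla : weight w S * la ^+ 2 = la by lra.
  have xE i : i \in S -> x i = w i * la.
    move=> iS; have /eqP := psumr_eq0P t0 Sum0 iS.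
    by rewrite mulf_eq0 invr_eq0 (gt_eqF (w_gt0 i)) orbF sqrf_eq0 subr_eq0 => /eqP.
  exists S; last by move=> i; rewrite ffunE; case: ifPn => [/xE|/xS].
  rewrite /wmaximum sS /=; apply/eqP/(mulIf (x := la ^+ 2)); last by rewrite wla alE.
  by rewrite expf_neq0 // gt_eqF.
move=> /forall_inPn[i iS] /forall_inPn[j jS]; rewrite negbK => eij.
have ij : i != j by apply: contraTneq eij => ->; rewrite e_irr.
have xi : 0 < x i by rewrite lt0r x0 andbT; move: iS; rewrite inE.
have xj : 0 < x j by rewrite lt0r x0 andbT; move: jS; rewrite inE.
pose d k : R := (k == i)%:R - (k == j)%:R.
have di : d i = 1 by rewrite /d eqxx (negPf ij) subr0.
have dj : d j = -1 by rewrite /d eqxx eq_sym (negPf ij) sub0r.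
have dk k : k != i -> k != j -> d k = 0.
  by rewrite /d => /negPf -> /negPf ->; rewrite subrr.
have sd : \sum_k d k = 0.
  have := sum_delta2 (fun=> 1 : R) i j.
  by under eq_bigr do rewrite mulr1; rewrite subrr.
pose y t k := x k + t * d k.
have Sy t : - x i <= t <= x j -> simplex (y t).
  move=> /andP[t1 t2]; split=> [k|]; last by rewrite big_split /= -mulr_sumr sd mulr0 addr0.
  rewrite /y; have [->|ki] := eqVneq k i; first by rewrite di; lra.
  have [->|kj] := eqVneq k j; first by rewrite dj; lra.
  by rewrite dk // mulr0 addr0.
have cy (t : R) (l : 'I_n) : l \in S -> y t l = 0 ->
  (#|[set k : 'I_n | y t k != 0%R]| < m)%N.
  move=> lS yl; rewrite -ltnS; apply: leq_trans cS; rewrite ltnS; apply: proper_card.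
  apply/properP; split; last by exists l; rewrite // inE yl eqxx.
  apply/subsetP => k; rewrite !inE; apply: contra => /eqP xk.
  have ki : k != i by apply: contraTneq xi => <-; rewrite xk ltxx.
  have kj : k != j by apply: contraTneq xj => <-; rewrite xk ltxx.
  by rewrite /y xk dk // mulr0 addr0.
have yj : y (x j) j = 0 by rewrite /y dj; ring.
have yi : y (- x i) i = 0 by rewrite /y di; ring.
have rj : - x i <= x j <= x j by apply/andP; split; lra.
have ri : - x i <= - x i <= x j by apply/andP; split; lra.
have [q1 e1] := IH _ (cy _ _ jS yj) (Sy _ rj).
have [q2 e2] := IH _ (cy _ _ iS yi) (Sy _ ri).
have E1 := qval_line B x d (x j); have E2 := qval_line B x d (- x i).
rewrite -/(y _) (qval_edge (Bsym i j)) in E1 E2.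
set c := B i i + B j j - 2 * B i j in E1 E2.
have c0 : c <= 0 by rewrite subr_le0; exact: Bedge.
(* x is the average of the endpoints t = x_j and t = - x_i with weights x_i and x_j; the term in c
   measures concavity along the segment. *)
have comb : x i * (qval B (y (x j)) - la) + x j * (qval B (y (- x i)) - la)
   - x i * x j * (x i + x j) * c = (x i + x j) * (qval B x - la).
  by rewrite E1 E2; ring.
have xij : 0 < x i * x j * (x i + x j) by rewrite !mulr_gt0 ?addr_gt0.
have t1 : 0 <= x i * (qval B (y (x j)) - la) by rewrite mulr_ge0 ?subr_ge0 // ltW.
have t2 : 0 <= x j * (qval B (y (- x i)) - la) by rewrite mulr_ge0 ?subr_ge0 // ltW.
have t3 : 0 <= - (x i * x j * (x i + x j) * c) by rewrite -mulrN mulr_ge0 ?oppr_ge0 // ltW.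
split=> [|qx].
  by rewrite -subr_ge0 -(pmulr_rge0 _ (addr_gt0 xi xj)) -comb; lra.
rewrite qx subrr mulr0 in comb.
have z1 : x i * (qval B (y (x j)) - la) = 0 by lra.
have z2 : x j * (qval B (y (- x i)) - la) = 0 by lra.
have z3 : x i * x j * (x i + x j) * c = 0 by lra.
(* In the equality case both endpoints are minimisers, with supports of the form R + i and R + j, so
   ij is critical; then [Bcrit] contradicts c = 0. *)
have /eqP := z1; rewrite mulf_eq0 gt_eqF //= subr_eq0 => /eqP /e1 [S1 w1 y1].
have /eqP := z2; rewrite mulf_eq0 gt_eqF //= subr_eq0 => /eqP /e2 [S2 w2 y2].
have /eqP := z3; rewrite mulf_eq0 gt_eqF //= => /eqP cE.
have m1 k : (k \in S1) = (y (x j) k != 0) by rewrite -wpoint_neq0 -y1.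
have m2 k : (k \in S2) = (y (- x i) k != 0) by rewrite -wpoint_neq0 -y2.
have : wcritical e w i j.
  rewrite /wcritical eij; apply/existsP; exists (S1 :\ i).
  rewrite setD1K; last by rewrite m1 /y di gt_eqF // mulr1 addr_gt0.
  rewrite w1 /=; suff -> : j |: S1 :\ i = S2 by [].
  apply/setP => k; rewrite !inE m1 m2 /y.
  have [->|kj] := eqVneq k j;
    first by rewrite ?eqxx /= dj mulrNN mulr1 (gt_eqF (addr_gt0 xj xi)).
  have [->|ki] := eqVneq k i; first by rewrite di !mulr1 subrr eqxx ?(negPf kj).
  by rewrite dk // !mulr0 addr0.
by move/Bcrit; rewrite -subr_lt0 -/c cE ltxx.
Qed.

(* Strict complementarity at the minimiser supported by S. *)
Lemma gradient_gt S i : wmaximum e w S -> i \notin S ->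
  1 < \sum_(j in S) B i j * w j.
Proof.
move=> wmaxS iS; have /andP[sS /eqP wS] := wmaxS.
pose T := [set j in S | e i j].
have TS : T \subset S by apply/subsetP => j; rewrite inE => /andP[].
have wi := w_gt0 i.
have iT : i \notin S :\: T by rewrite inE negb_and iS orbT.
have wsplit : weight w (S :\: T) = alpha e w - weight w T.
  apply/eqP; rewrite eq_sym subr_eq -wS /weight (big_setID T) /= (setIidPr TS).
  by rewrite addrC.
(* Exchanging i for its neighbours T in S keeps stability, so maximality of S forces w(T) >= w_i. *)
have sT : stable e (i |: S :\: T).
  apply/stableP => a b; rewrite !in_setU1 !in_setD ![_ \in T]inE.
  move=> /predU1P[->|/andP[Ta aS]] /predU1P[->|/andP[Tb bS]]; first by rewrite e_irr.
  - by move: Tb; rewrite bS.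
  - by rewrite e_sym; move: Ta; rewrite aS.
  - exact: (stableP _ sS).
have wU : weight w (i |: S :\: T) = w i + (alpha e w - weight w T).
  by rewrite -wsplit /weight big_setU1.
have wT : w i <= weight w T by have := weight_le_alpha sT; rewrite wU; lra.
have sumT : \sum_(j in S) B i j * w j = \sum_(j in T) B i j * w j.
  rewrite (big_setID T) /= (setIidPr TS) [X in _ + X]big1 ?addr0 // => j.
  rewrite !inE => /andP[+ jS]; rewrite jS /= => eij.
  by rewrite Bnon ?mul0r //; apply: contraNneq iS => ->.
have term j : j \in T -> 2^-1 * (w j / w i) + 2^-1 <= B i j * w j.
  rewrite inE => /andP[_ eij]; have := Bedge eij; rewrite !Bdiag => h.
  have wj := w_gt0 j.
  have -> : 2^-1 * (w j / w i) + 2^-1 = 2^-1 * ((w i)^-1 + (w j)^-1) * w j.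
    by field; rewrite !gt_eqF.
  by rewrite ler_pM2r //; lra.
have [j jT] : exists j, j \in T.
  apply/set0Pn; apply: contraTneq wT => ->.
  by rewrite /weight big_set0 -ltNge.
have [jS eij] : j \in S /\ e i j by move: jT; rewrite inE => /andP[].
have wj := w_gt0 j.
(* If T = {j}, either w_j > w_i gives strictness, or w_j = w_i makes ij critical and [Bcrit] does.
   If T has two or more elements, the bounds [term] already add up to at least 1/2 + 1. *)
rewrite sumT; have [TE|TE] := eqVneq T [set j].
  rewrite TE big_set1; move: wT; rewrite TE /weight big_set1 => wij.
  have := term j jT; have [wlt|] := ltP (w i) (w j).
    by apply: lt_le_trans; have : 1 < w j / w i by [rewrite ltr_pdivlMr // mul1r]; lra.
  move=> wle _; have wE : w j = w i by apply/eqP; rewrite eq_le wle.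
  have : wcritical e w i j.
    rewrite /wcritical eij; apply/existsP; exists (S :\ j); rewrite setD1K // wmaxS andbT.
    by rewrite -TE /wmaximum sT wU TE /weight big_set1 wE addrC subrK /=.
  move/Bcrit; rewrite !Bdiag wE => h.
  by rewrite -ltr_pdivrMr // div1r; lra.
apply: (@lt_le_trans _ _ (\sum_(k in T) (2^-1 * (w k / w i) + 2^-1))); last exact: ler_sum.
rewrite big_split /= -mulr_sumr -mulr_suml -/(weight w T) sumr_const -[X in _ + X]mulr_natl.
have : 1 <= weight w T / w i by rewrite ler_pdivlMr // mul1r.
have : (2%:R : R) <= #|T|%:R.
  rewrite ler_nat ltnNge; apply: contra TE => T1.
  by rewrite eq_sym eqEcard sub1set jT cards1.
lra.
Qed.

Lemma sos_binary (a b c : R) (p q : {mpoly R[n]}) : 0 < a -> b ^+ 2 <= 4 * a * c ->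
  sos (a%:MP * p ^+ 2 + b%:MP * (p * q) + c%:MP * q ^+ 2).
Proof.
move=> a0 bac.
have -> : a%:MP * p ^+ 2 + b%:MP * (p * q) + c%:MP * q ^+ 2 =
   a%:MP * (p + (b / (2 * a))%:MP * q) ^+ 2 + (c - b ^+ 2 / (4 * a))%:MP * q ^+ 2.
  have -> : b = a * (b / (2 * a)) * 2 by field; rewrite gt_eqF.
  set t := b / (2 * a).
  have -> : c - (a * t * 2) ^+ 2 / (4 * a) = c - a * t ^+ 2 by field; rewrite gt_eqF.
  have -> : a * t * 2 / (2 * a) = t by field; rewrite gt_eqF.
  ring.
apply: sos_add; apply: sosM; try exact: sos_sqr; apply: sosC; first exact: ltW.
by rewrite subr_ge0 ler_pdivrMr ?mulr_gt0 // mulrC.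
Qed.

(* The diagonal block of B on a stable set is positive definite, and a large multiple
   of the squares of the other variables dominates all the remaining terms. *)
Lemma sos_dominated (S : {set 'I_n}) (D : 'I_n -> {mpoly R[n]}) : stable e S ->
  exists d g : R, [/\ 0 < d, 0 < g &
    sos (\sum_i \sum_j (B i j)%:MP * (D i * D j)
         + g%:MP * (\sum_(i | i \notin S) D i ^+ 2) - d%:MP * (\sum_i D i ^+ 2))].
Proof.
move=> /stableP sS.
pose W := \sum_i w i.
have wW i : w i <= W.
  by rewrite /W (bigD1 i) //= lerDl; apply: sumr_ge0 => j _; exact: ltW.
have W0 : 0 < W by apply: lt_le_trans (wW (Ordinal n_gt0)).
pose mu := W^-1; have mu0 : 0 < mu by rewrite invr_gt0.
have muw i : mu <= (w i)^-1 by rewrite lef_pV2 ?posrE.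
have nn0 : 0 < n%:R :> R by rewrite ltr0n.
(* Each square receives eta from 2 n pairs, which uses mu / 2 of the diagonal mass mu. Below, g0 is
   the value meeting the discriminant condition B_ij^2 <= 4 eta g0. *)
pose eta := mu / (4 * n%:R); have eta0 : 0 < eta by rewrite divr_gt0 ?mulr_gt0.
pose b := \sum_i \sum_j B i j ^+ 2.
have bB i j : B i j ^+ 2 <= b.
  rewrite /b (bigD1 i) //= (bigD1 j) //= -addrA lerDl addr_ge0 ?sumr_ge0 // => k _.
    exact: sqr_ge0.
  by apply: sumr_ge0 => l _; exact: sqr_ge0.
have b0 : 0 <= b by apply: le_trans (bB (Ordinal n_gt0) (Ordinal n_gt0)); exact: sqr_ge0.
pose g0 := b / (4 * eta).
have g00 : 0 <= g0 by rewrite divr_ge0 // mulr_ge0 // ltW.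
have Bg i j : B i j ^+ 2 <= 4 * eta * g0.
  by rewrite /g0 mulrCA mulfV ?mulr1 // gt_eqF // mulr_gt0.
pose o i : R := (i \notin S)%:R.
pose s i : R := (i \in S)%:R.
(* The correction terms are shared out among the pairs so that each pair alone is a sum of squares:
   on S x S the off-diagonal entries vanish, and elsewhere [sos_binary] applies. *)
pose T i j := (B i j)%:MP * (D i * D j) - ((i == j)%:R * s i * (w i)^-1)%:MP * D j ^+ 2
   + eta%:MP * (D i ^+ 2 + D j ^+ 2) + g0%:MP * ((o i)%:MP * D i ^+ 2 +
     (o j)%:MP * D j ^+ 2).
have simp := (mulr0n, mulr1n, mul0r, mulr0, mul1r, mulr1, mpolyC0, mpolyC1).
have sosT i j : sos (T i j).
  have sq c k : 0 <= c -> sos (c%:MP * D k ^+ 2).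
    by move=> c0; apply: sosM; [exact: sosC|exact: sos_sqr].
  have o0 k : 0 <= g0 * o k by rewrite mulr_ge0.
  have [iS|iS] := boolP (i \in S); have [jS|jS] := boolP (j \in S).
  - have -> : T i j = eta%:MP * D i ^+ 2 + eta%:MP * D j ^+ 2.
      rewrite /T /o /s iS jS; have [<-|ij] := eqVneq i j.
        by rewrite Bdiag /= !simp; ring.
      by rewrite Bnon ?sS //= !simp; ring.
    by apply: sos_add; apply: sq; exact: ltW.
  - have -> : T i j = (eta%:MP * D i ^+ 2 + (B i j)%:MP * (D i * D j) + g0%:MP * D j ^+ 2)
        + eta%:MP * D j ^+ 2.
      rewrite /T /o /s iS jS; have [ij|_] := eqVneq i j; first by rewrite -ij iS in jS.
      by rewrite /= !simp; ring.
    by apply: sos_add; [exact: sos_binary|apply: sq; exact: ltW].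
  - have -> : T i j = (eta%:MP * D j ^+ 2 + (B i j)%:MP * (D j * D i) + g0%:MP * D i ^+ 2)
        + eta%:MP * D i ^+ 2.
      rewrite /T /o /s (negPf iS) jS.
      by rewrite /= !simp; ring.
    by apply: sos_add; [exact: sos_binary|apply: sq; exact: ltW].
  - have -> : T i j = (eta%:MP * D i ^+ 2 + (B i j)%:MP * (D i * D j) + g0%:MP * D j ^+ 2)
        + (eta%:MP * D j ^+ 2 + g0%:MP * D i ^+ 2).
      rewrite /T /o /s (negPf iS) (negPf jS).
      by rewrite /= !simp; ring.
    apply: sos_add; first exact: sos_binary.
    by apply: sos_add; apply: sq; rewrite ?(ltW eta0).
pose A := \sum_i D i ^+ 2; pose O := \sum_i (o i)%:MP * D i ^+ 2.
have OE : \sum_(i | i \notin S) D i ^+ 2 = O.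
  rewrite big_mkcond; apply: eq_bigr => i _; rewrite /o; case: (i \in S) => /=.
    by rewrite mpolyC0 mul0r.
  by rewrite mpolyC1 mul1r.
exists (mu / 2), (2 * n%:R * g0 + mu); split; [by rewrite divr_gt0| |].
  have : 0 <= 2 * n%:R * g0 by rewrite mulr_ge0 // mulr_ge0 // ler0n.
  lra.
have rowT i : \sum_j T i j = \sum_j (B i j)%:MP * (D i * D j)
    - (s i * (w i)^-1)%:MP * D i ^+ 2 + eta%:MP * (n%:R%:MP * D i ^+ 2 + A)
    + g0%:MP * (n%:R%:MP * ((o i)%:MP * D i ^+ 2) + O).
  have cst (p : {mpoly R[n]}) : \sum_(j < n) p = n%:R%:MP * p.
    by rewrite sumr_const card_ord mpolyC_nat mulr_natl.
  rewrite /T !big_split /= -!mulr_sumr !big_split /= !cst sumrN; congr (_ - _ + _ + _).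
  rewrite (bigD1 i) //= eqxx mul1r big1 ?addr0 // => j ji.
  by rewrite eq_sym (negPf ji) /= !simp.
have sumT : \sum_i \sum_j T i j = \sum_i \sum_j (B i j)%:MP * (D i * D j)
    - \sum_i (s i * (w i)^-1)%:MP * D i ^+ 2 + (2 * n%:R * eta)%:MP * A
    + (2 * n%:R * g0)%:MP * O.
  have cst (p : {mpoly R[n]}) : \sum_(j < n) p = n%:R%:MP * p.
    by rewrite sumr_const card_ord mpolyC_nat mulr_natl.
  under eq_bigr do rewrite rowT.
  rewrite !big_split /= -!mulr_sumr !big_split /= -!mulr_sumr !cst sumrN -/A -/O.
  rewrite !mpolyCM; ring.
rewrite OE -/A.
have -> : \sum_i \sum_j (B i j)%:MP * (D i * D j) + (2 * n%:R * g0 + mu)%:MP * O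
    - (mu / 2)%:MP * A
    = \sum_i \sum_j T i j + \sum_i (s i * ((w i)^-1 - mu))%:MP * D i ^+ 2.
  rewrite sumT.
  have -> : 2 * n%:R * eta = mu / 2 by rewrite /eta; field; rewrite gt_eqF.
  have -> : \sum_i (s i * ((w i)^-1 - mu))%:MP * D i ^+ 2 =
      \sum_i (s i * (w i)^-1)%:MP * D i ^+ 2 - mu%:MP * (A - O).
    rewrite /A /O -sumrB mulr_sumr -sumrB; apply: eq_bigr => i _.
    have -> : s i = 1 - o i by rewrite /s /o; case: (i \in S) => /=; rewrite ?subr0 ?subrr.
    ring.
  have muE : mu = mu / 2 + mu / 2 by field.
  by move: muE; set h := mu / 2 => ->; ring.
apply: sos_add; first by do 2!(apply: sos_sum => ? _); exact: sosT.
apply: sos_sum => i _; apply: sosM; last exact: sos_sqr.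
by apply: sosC; rewrite mulr_ge0 // subr_ge0.
Qed.

(** The Taylor expansion at z is exact. With multiplier 2 / alpha for the simplex equation, the
    linear coefficients 2 c_k vanish on S and are positive off S by [gradient_gt], where moreover
    z_k = 0. *)
Lemma locally_pos_wpoint S : wmaximum e w S ->
  locally_pos (@simplex_qm R n) (wpoint S) (qform B - la%:MP).
Proof.
move=> wmaxS; have /andP[sS /eqP wS] := wmaxS.
have [z0 z1] := simplex_wpoint wmaxS.
set z := wpoint S in z0 z1 *.
pose D := shiftX z.
have [d [g [d0 g0 sosQ]]] := sos_dominated D sS.
pose Bz k := \sum_l B k l * z l.
pose c k := Bz k - la.
have la0 : 0 < la by rewrite invr_gt0.
have cS k : k \in S -> c k = 0.
  move=> kS; rewrite /c /Bz sum_wpoint (bigD1 k) //= Bdiag mulVf ?gt_eqF //.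
  rewrite big1 ?addr0 ?mul1r ?subrr // => l /andP[lS lk].
  by rewrite Bnon ?mul0r ?(stableP _ sS) // eq_sym.
have cNS k : k \notin S -> 0 < c k.
  move=> kS; rewrite /c /Bz sum_wpoint subr_gt0 /la -[X in X < _]mul1r ltr_pM2r //.
  exact: gradient_gt.
have XS k : k \notin S -> D k = 'X_k.
  by move=> /negPf kS; rewrite /D /shiftX ffunE kS mpolyC0 subr0.
have sumD : \sum_k D k = simplex_eqn R n.
  by rewrite /D /shiftX sumrB -(raddf_sum (@mpolyC n R)) z1 /= mpolyC1.
have qE : qform B - la%:MP = \sum_i \sum_j (B i j)%:MP * (D i * D j)
   + \sum_(k | k \notin S) (2 * c k)%:MP * 'X_k + (2 * la)%:MP * simplex_eqn R n.
  have -> : \sum_(k | k \notin S) (2 * c k)%:MP * 'X_k = \sum_k (2 * c k)%:MP * D k.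
    rewrite [RHS](bigID (fun k => k \in S)) /= [X in _ = X + _]big1 ?add0r.
      by apply: eq_bigr => k /XS ->.
    by move=> k /cS ->; rewrite mulr0 mpolyC0 mul0r.
  rewrite -sumD mulr_sumr -addrA -big_split /=.
  have -> : \sum_(k < n) ((2 * c k)%:MP * D k + (2 * la)%:MP * D k) =
      \sum_k (Bz k)%:MP * D k + \sum_k (Bz k)%:MP * D k :> {mpoly R[n]}.
    by rewrite -big_split; apply: eq_bigr => k _; rewrite /c /=; ring.
  have -> : qform B = \sum_i \sum_j (B i j)%:MP * (D i * D j)
     + (\sum_i \sum_j (B i j)%:MP * (D i * (z j)%:MP)
     + \sum_i \sum_j (B i j)%:MP * ((z i)%:MP * D j)) + (qval B z)%:MP.
    rewrite /qval raddf_sum -!big_split; apply: eq_bigr => i _ /=.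
    rewrite raddf_sum -!big_split; apply: eq_bigr => j _ /=.
    rewrite -mul_mpolyC /D /shiftX !mpolyCM; ring.
  rewrite qval_wpoint // addrK; congr (_ + (_ + _)).
    apply: eq_bigr => i _; rewrite /Bz raddf_sum mulr_suml; apply: eq_bigr => j _.
    by rewrite /= mpolyCM; ring.
  rewrite exchange_big; apply: eq_bigr => j _ /=; rewrite /Bz raddf_sum mulr_suml.
  by apply: eq_bigr => i _; rewrite /= mpolyCM Bsym; ring.
(* X_k = X_k (1 - C X_k / 2)^2 + C X_k^2 - C^2 X_k^3 / 4 trades the linear term for a
   large multiple of X_k^2. *)
pose C k := g / (2 * c k).
pose m1 := \sum_i \sum_j (B i j)%:MP * (D i * D j)
         + g%:MP * (\sum_(i | i \notin S) D i ^+ 2) - d%:MP * (\sum_i D i ^+ 2).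
pose m2 := \sum_(k | k \notin S) ((2 * c k)%:MP * (1 - (C k / 2)%:MP * 'X_k) ^+ 2) * 'X_k
   : {mpoly R[n]}.
pose p := \sum_(k | k \notin S) (D k * D k) * ((- (g * C k / 4))%:MP * D k).
have qS := simplex_qmodule R n.
exists d, (m1 + m2 + (2 * la)%:MP * simplex_eqn R n), p; split=> //.
- apply: (qmD qS); last exact: simplex_qm_ideal.
  apply: (qmD qS); first exact: (qm_sos qS).
  apply: (qm_sum qS) => k kS; apply: (qm_sosM qS); last exact: simplex_qm_coord.
  by apply: sosM; [apply/sosC/mulr_ge0 => //; exact/ltW/cNS|exact: sos_sqr].
- apply: ideal_cube_sum => k _; apply: ideal_cubeM.
    by apply: ideal_sqrM; rewrite shiftXE subrr.
  by rewrite mevalM shiftXE subrr mulr0.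
rewrite qE -mul_mpolyC /m1 /dist2 -/D.
have -> : \sum_(k | k \notin S) (2 * c k)%:MP * 'X_k =
   m2 + g%:MP * (\sum_(i | i \notin S) D i ^+ 2) + p.
  rewrite mulr_sumr -!big_split; apply: eq_bigr => k kS /=; rewrite XS //.
  have ck := cNS _ kS.
  have -> : g = 2 * c k * C k by rewrite /C; field; rewrite gt_eqF.
  set t := C k.
  have -> : 2 * c k * t * t / 4 = 2 * c k * (t / 2) * (t / 2) by field.
  have tE : t = t / 2 + t / 2 by field.
  by move: tE; set h := t / 2 => ->; ring.
ring.
Qed.

Theorem qform_simplex_qm : simplex_qm (qform B - la%:MP).
Proof.
pose Z := undup [seq wpoint T | T <- enum (wmaximum e w)].
have ZP y : reflect (exists2 S, wmaximum e w S & y = wpoint S) (y \in Z).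
  rewrite mem_undup; apply: (iffP mapP) => [[S]|[S wS ->]].
    by rewrite mem_enum => wS ->; exists S.
  by exists S; rewrite ?mem_enum.
apply: (@local_global _ _ _ Z); [exact: simplex_qmodule|exact: simplex_archimedean|
  exact: undup_uniq| |].
  move=> y /ZP[S wS ->]; split; last exact: locally_pos_wpoint.
    by apply/simplex_locus/simplex_wpoint.
  by rewrite mevalB mevalC qformE qval_wpoint // subrr.
move=> x /simplex_locus Sx xZ; rewrite mevalB mevalC qformE subr_gt0.
have [le_q eq_q] := motzkin_straus Sx; rewrite lt_neqAle le_q andbT.
apply/eqP => /esym/eq_q[S wS xE].
have /xZ : wpoint S \in Z by apply/ZP; exists S.
by rewrite dist2E big1 ?ltxx // => k _; rewrite xE subrr expr0n.
Qed.

End Matrix.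
End StableSets.

(** * Homogenisation *)

Section EvenPart.
Variable A : comNzRingType.
Implicit Types (f g : {poly A}).

Lemma even_poly_split f g : even_poly (f \Po 'X^2 + (g \Po 'X^2) * 'X) = f.
Proof.
rewrite even_polyD even_polyMX.
have -> : odd_poly (g \Po 'X^2) = 0.
  by apply/polyP => i; rewrite coef_odd_poly coef_comp_poly_Xn // dvdn2 /= odd_double coef0.
rewrite mul0r addr0; apply/polyP => i.
by rewrite coef_even_poly coef_comp_poly_Xn // dvdn2 odd_double -muln2 mulnK.
Qed.

(** The cross term is odd and drops out. The right side remains a sum of squares when X is replaced
    by one. *)
Lemma even_poly_sqr f : even_poly (f ^+ 2) = even_poly f ^+ 2 + 'X * odd_poly f ^+ 2.
Proof.
rewrite -{1}(poly_even_odd f).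
set a := even_poly f; set b := odd_poly f.
rewrite -[RHS](even_poly_split _ (2%:R * a * b)); congr even_poly.
rewrite !(rmorphD, rmorphM, rmorphXn, rmorph_nat) /= comp_polyX; ring.
Qed.

Lemma even_polyM_comp f g : even_poly (f * (g \Po 'X^2)) = even_poly f * g.
Proof.
rewrite -{1}(poly_even_odd f) -[RHS](even_poly_split _ (odd_poly f * g)).
by congr even_poly; rewrite !rmorphM /=; ring.
Qed.

(* N^k * f(1/N). *)
Definition rev_eval (N : A) k f : A := \sum_(i < k.+1) f`_i * N ^+ (k - i).

Lemma rev_evalD N k f g : rev_eval N k (f + g) = rev_eval N k f + rev_eval N k g.
Proof.
by rewrite -big_split; apply: eq_bigr => i _; rewrite coefD mulrDl.
Qed.

Lemma rev_eval_sum N k (I : Type) (r : seq I) (F : I -> {poly A}) :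
  rev_eval N k (\sum_(i <- r) F i) = \sum_(i <- r) rev_eval N k (F i).
Proof.
elim: r => [|i r IH]; last by rewrite !big_cons rev_evalD IH.
by rewrite !big_nil /rev_eval big1 // => i _; rewrite coef0 mul0r.
Qed.

Lemma rev_evalZXn N k c j : (j <= k)%N -> rev_eval N k (c *: 'X^j) = c * N ^+ (k - j).
Proof.
rewrite -ltnS => jk; rewrite /rev_eval (bigD1 (Ordinal jk)) //= coefZ coefXn eqxx mulr1.
rewrite big1 ?addr0 // => i ij; rewrite coefZ coefXn.
by rewrite (_ : (i == j :> nat) = false) ?mulr0 ?mul0r //; apply/negbTE.
Qed.

(** The size bounds ensure that no coefficient is cut off and that the exponents of N add up. *)
Lemma rev_evalM N a b f g : (size f <= a.+1)%N -> (size g <= b.+1)%N ->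
  rev_eval N (a + b) (f * g) = rev_eval N a f * rev_eval N b g.
Proof.
move=> fa gb.
have wide (h : {poly A}) k : (size h <= k.+1)%N -> h = \sum_(i < k.+1) h`_i *: 'X^i.
  move=> hk; rewrite -[LHS]coefK; apply/polyP => i.
  rewrite coef_poly -poly_def coef_poly ltnS; case: ltnP => hi;
    first by rewrite -ltnS (leq_trans hi hk).
  by case: ifP => // _; rewrite nth_default.
rewrite {1}(wide f a fa) {1}(wide g b gb) mulr_suml rev_eval_sum.
rewrite [in RHS]/rev_eval mulr_suml; apply: eq_bigr => i _.
rewrite mulr_sumr rev_eval_sum mulr_sumr; apply: eq_bigr => j _.
rewrite -scalerAl -scalerAr -exprD scalerA.
have ia : (i <= a)%N by rewrite -ltnS.
have jb : (j <= b)%N by rewrite -ltnS.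
rewrite rev_evalZXn ?leq_add //.
have -> : (a + b - (i + j) = (a - i) + (b - j))%N by rewrite addnBA // addnBAC // subnDA.
by rewrite exprD; ring.
Qed.

End EvenPart.

Section Homogenisation.
Variables (R : realType) (n : nat).
Implicit Types (p q u : {mpoly R[n]}).

(* The coefficient of T^d is the homogeneous component of degree d. *)
Definition grading p : {poly {mpoly R[n]}} :=
  mmap (polyC \o @mpolyC n R) (fun i => ('X_i)%:P * 'X) p.

Lemma gradingM p q : grading (p * q) = grading p * grading q.
Proof. exact: rmorphM. Qed.

Lemma gradingD p q : grading (p + q) = grading p + grading q.
Proof. exact: mmapD. Qed.

Lemma gradingX i : grading 'X_i = ('X_i)%:P * 'X.
Proof. by rewrite /grading mmapX mmap1U. Qed.

Lemma gradingC c : grading c%:MP = (c%:MP)%:P.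
Proof. by rewrite /grading mmapC. Qed.

Lemma grading_sum (I : Type) (r : seq I) (F : I -> {mpoly R[n]}) :
  grading (\sum_(i <- r) F i) = \sum_(i <- r) grading (F i).
Proof. exact: raddf_sum. Qed.

Let N : {mpoly R[n]} := \sum_(i < n) 'X_i ^+ 2.

Let gradingN : grading (N - 1) = (N%:P * 'X - 1) \Po 'X^2.
Proof.
rewrite -mpolyC1 -mpolyCN gradingD gradingC mpolyCN mpolyC1 rmorphB rmorphM /=.
rewrite comp_polyC comp_polyX rmorph1 polyCN polyC1; congr (_ - _).
rewrite /N grading_sum raddf_sum mulr_suml; apply: eq_bigr => i _ /=.
by rewrite expr2 gradingM gradingX polyCM; ring.
Qed.

(* Taking the even part of the grading and putting T^2 = 1/N, up to a power of N. *)
Lemma sos_homogenise p s u :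
  grading p = p%:P * 'X^4 -> sos s -> p = s + u * (N - 1) ->
  exists r, sos (N ^+ r * p).
Proof.
move=> gp [qs sE] pE.
pose k := (\sum_(q <- qs) size (grading q) + size (grading u) + 1)%N.
have qk q : q \in qs -> (size (grading q) <= k)%N.
  move=> qin; rewrite /k (big_rem q) //= -!addnA; exact: leq_addr.
have uk : (size (grading u) <= k)%N by rewrite /k addnAC leq_addl.
have k0 : (0 < k)%N by rewrite /k addn1.
have szE (f : {poly {mpoly R[n]}}) : (size f <= k)%N -> (size (even_poly f) <= k.+1)%N.
  by move=> fk; apply: leq_trans (size_even_poly _) _; lia.
have szO (f : {poly {mpoly R[n]}}) : (size f <= k)%N -> (size (odd_poly f) <= k.-1.+1)%N.
  by move=> fk; rewrite prednK //; apply: leq_trans (size_odd_poly _) _; lia.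
exists (2 * k - 2)%N.
(* p is homogeneous of degree 4, so its grading has T^4 = 1 / N^2; this is where the exponent 2 k -
   2 comes from. *)
have lhs : rev_eval N (2 * k) (even_poly (grading p)) = N ^+ (2 * k - 2) * p.
  have -> : grading p = (p%:P * 'X^2) \Po 'X^2.
    by rewrite gp rmorphM rmorphXn /= comp_polyC comp_polyX -exprM.
  rewrite -[X in even_poly X]mul1r even_polyM_comp even_polyC mul1r mul_polyC.
  rewrite rev_evalZXn; first by rewrite mulrC.
  by lia.
rewrite -lhs {1}pE gradingD gradingM gradingN even_polyD rev_evalD even_polyM_comp.
(* The multiple of N - 1 dies because N X - 1 vanishes at X = 1 / N; one unit of the order is
   reserved for this factor. *)
have -> : rev_eval N (2 * k) (even_poly (grading u) * (N%:P * 'X - 1)) = 0.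
  have -> : (2 * k = (2 * k).-1 + 1)%N by lia.
  rewrite rev_evalM.
  - rewrite [X in _ * X]/rev_eval 2!big_ord_recl big_ord0 /= !coefB !coefCM !coefX !coef1
    /=.
    by rewrite expr0 expr1; ring.
  - apply: leq_trans (szE _ uk) _.
    by lia.
  - rewrite -polyC1 -polyCN; apply: leq_trans (size_polyD _ _) _.
    rewrite geq_max (leq_trans (size_polyC_leq1 _)) // andbT mul_polyC.
    by apply: leq_trans (size_scale_leq _ _) _; rewrite size_polyX.
rewrite addr0 sE grading_sum.
have evsum (r : seq {mpoly R[n]}) :
    even_poly (\sum_(q <- r) grading (q ^+ 2)) = \sum_(q <- r) even_poly (grading q ^+ 2).
  rewrite raddf_sum; apply: eq_bigr => q _ /=.
  by rewrite [in LHS]expr2 gradingM -expr2.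
rewrite evsum rev_eval_sum big_seq_cond; apply: sos_sum => q; rewrite andbT => /qk qin.
rewrite even_poly_sqr rev_evalD; apply: sos_add.
  rewrite expr2 mul2n -addnn rev_evalM; [|exact: szE|exact: szE].
  by rewrite -expr2; exact: sos_sqr.
(* X is reversed at order 2, which turns it into the sum of squares N and leaves an even order to
   share between the two odd parts. *)
have -> : (2 * k = 2 + (k.-1 + k.-1))%N.
  by lia.
rewrite expr2 rev_evalM; first last.
- apply: leq_trans (size_polyMleq _ _) _.
  by have := szO _ qin; move: (size (odd_poly _)) => t; clear -k0; lia.
- by rewrite size_polyX.
apply: sosM; last first.
  rewrite rev_evalM; [|exact: szO|exact: szO].
  by rewrite -expr2; exact: sos_sqr.
rewrite -['X]scale1r -['X]expr1 rev_evalZXn // mul1r expr1.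
by apply: sos_sum => i _; exact: sos_sqr.
Qed.

End Homogenisation.

(** * From certificates to the two hierarchies *)

Section Bounds.
Variables (R : realType) (n : nat) (B : 'M[R]_n).

Lemma p_feasible_of_simplex_qm l : simplex_qm (qform B - l%:MP) ->
  exists2 r, (1 <= r)%N & p_feasible B r l.
Proof.
move=> [s0 [s [u [s00 sj E]]]].
pose r := (msize s0 + \sum_j msize (s j * 'X_j) + msize (u * simplex_eqn R n)).+1.
exists r => //; exists (s0 + \sum_(j < n) s j * 'X_j), (u * simplex_eqn R n).
split=> //; last by exists u => //; rewrite /deg_le -/(simplex_eqn R n) /r; lia.
exists s0, s; split=> // [|j]; first by rewrite /deg_le /r; lia.
by rewrite /deg_le /r (bigD1 j) //=; lia.
Qed.

Lemma p_feasible_ub r l x : simplex x -> p_feasible B r l -> l <= qval B x.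
Proof.
move=> Sx [q [h [[s0 [s [[s00 sj] _ _ qE]]] [u _ hE] E]]].
have : simplex_qm (qform B - l%:MP).
  by exists s0, s, u; split=> //; rewrite E qE hE.
by move/simplex_qm_ge0 => /(_ x Sx); rewrite mevalB mevalC qformE subr_ge0.
Qed.

Let N : {mpoly R[n]} := \sum_(i < n) 'X_i ^+ 2.

Definition quartic (M : 'M[R]_n) : {mpoly R[n]} :=
  \sum_(i < n) \sum_(j < n) M i j *: ('X_i ^+ 2 * 'X_j ^+ 2).

Let sub_sqr (p : {mpoly R[n]}) : {mpoly R[n]} :=
  mmap (@mpolyC n R) (fun i => 'X_i ^+ 2) p.

Let sub_sqrM p q : sub_sqr (p * q) = sub_sqr p * sub_sqr q.
Proof. exact: rmorphM. Qed.

Let sub_sqrD p q : sub_sqr (p + q) = sub_sqr p + sub_sqr q.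
Proof. exact: mmapD. Qed.

Let sub_sqrX i : sub_sqr 'X_i = 'X_i ^+ 2.
Proof. by rewrite /sub_sqr mmapX mmap1U. Qed.

Let sub_sqrC c : sub_sqr c%:MP = c%:MP.
Proof. by rewrite /sub_sqr mmapC. Qed.

Let sub_sqr_sum (I : Type) (r : seq I) (F : I -> {mpoly R[n]}) :
  sub_sqr (\sum_(i <- r) F i) = \sum_(i <- r) sub_sqr (F i).
Proof. exact: raddf_sum. Qed.

Let sub_sqr_sos p : sos p -> sos (sub_sqr p).
Proof.
move=> [t ->]; rewrite sub_sqr_sum; apply: sos_sum => q _.
by rewrite expr2 sub_sqrM -expr2; exact: sos_sqr.
Qed.

Let sub_sqr_qform M : sub_sqr (qform M) = quartic M.
Proof.
rewrite /qform sub_sqr_sum; apply: eq_bigr => i _; rewrite sub_sqr_sum.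
apply: eq_bigr => j _; rewrite -!mul_mpolyC sub_sqrM sub_sqrC sub_sqrM.
by rewrite !sub_sqrX.
Qed.

Let sub_sqr_eqn : sub_sqr (simplex_eqn R n) = N - 1.
Proof.
rewrite /simplex_eqn -mpolyC1 -mpolyCN sub_sqrD sub_sqrC sub_sqr_sum; congr (_ + _).
by apply: eq_bigr => i _; rewrite sub_sqrX.
Qed.

Let quartic_const l : quartic (B - l *: const_mx 1) = quartic B - l%:MP * N ^+ 2.
Proof.
rewrite /quartic /N expr2 mulr_suml mulr_sumr -sumrB; apply: eq_bigr => i _.
rewrite !mulr_sumr -sumrB; apply: eq_bigr => j _.
by rewrite !mxE mulr1 -!mul_mpolyC mpolyCB; ring.
Qed.

Let grading_quartic M : grading (quartic M) = (quartic M)%:P * 'X^4.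
Proof.
rewrite /quartic grading_sum raddf_sum mulr_suml; apply: eq_bigr => i _ /=.
rewrite grading_sum raddf_sum mulr_suml; apply: eq_bigr => j _ /=.
rewrite -!mul_mpolyC !expr2 !gradingM gradingC !gradingX !polyCM; ring.
Qed.

Lemma Theta_feasible_of_simplex_qm l : B^T = B -> simplex_qm (qform B - l%:MP) ->
  exists r, Theta_feasible B r l.
Proof.
move=> Bs [s0 [s [u [s00 sj E]]]].
(* Homogenising replaces the constant l by l N^2; the difference l - l N^2 = - l (N + 1)(N - 1) goes
   into the multiplier of N - 1. *)
have [||r sr] := @sos_homogenise R n (quartic (B - l *: const_mx 1))
    (sub_sqr s0 + \sum_(j < n) sub_sqr (s j) * 'X_j ^+ 2)
    (sub_sqr u - l%:MP * (N + 1)) (grading_quartic _).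
- apply: sos_add; first exact: sub_sqr_sos.
  by apply: sos_sum => j _; apply: sosM; [exact: sub_sqr_sos|exact: sos_sqr].
- have := congr1 sub_sqr E; rewrite -mpolyCN !sub_sqrD sub_sqr_qform sub_sqrC.
  rewrite sub_sqrM sub_sqr_eqn sub_sqr_sum quartic_const.
  under eq_bigr do rewrite sub_sqrM sub_sqrX.
  rewrite mpolyCN => /(canRL (addrNK _)) ->; rewrite -/N; ring.
exists r; split; last exact: sr.
by rewrite linearB linearZ /= trmx_const Bs.
Qed.

(** Evaluation at the square roots of the x_i, where the factor N^r equals 1. *)
Lemma Theta_feasible_ub r l x : simplex x -> Theta_feasible B r l -> l <= qval B x.
Proof.
move=> [x0 x1] [_ /sos_ge0].
move=> /(_ (fun i => Num.sqrt (x i))); rewrite -/(quartic _) quartic_const -/N.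
have xE i : Num.sqrt (x i) ^+ 2 = x i by rewrite sqr_sqrtr.
have NE : N.@[fun i => Num.sqrt (x i)] = 1.
  rewrite raddf_sum -[RHS]x1; apply: eq_bigr => i _ /=.
  by rewrite rmorphXn /= mevalXU xE.
rewrite mevalM rmorphXn /= NE expr1n mul1r mevalB mevalM mevalC rmorphXn /= NE.
rewrite expr1n mulr1 subr_ge0; congr (_ <= _).
rewrite raddf_sum; apply: eq_bigr => i _; rewrite raddf_sum; apply: eq_bigr => j _ /=.
by rewrite mevalZ mevalM !rmorphXn /= !mevalXU !xE.
Qed.

End Bounds.

Lemma Bw_MGw (R : realType) (n : nat) (e : rel 'I_n) (w : 'I_n -> R) :
  symmetric e -> irreflexive e -> MGw e w (Bw e w).
Proof.
move=> e_sym e_irr; split=> [|i|i j eij|i j ij eij]; rewrite ?mxE ?eqxx //.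
- apply/matrixP => i j; rewrite !mxE eq_sym e_sym; case: eqVneq => [->//|_].
  by case: ifP; rewrite // addrC.
- have ij : i != j by apply: contraTneq eij => ->; rewrite e_irr.
  by rewrite (negPf ij) eij.
- by rewrite (negPf ij) (negPf eij).
Qed.

(** Both values are squeezed: the certificate makes 1 / alpha feasible at some order, and evaluation
    at one [wpoint S], where the form equals 1 / alpha, bounds every feasible value at every
    order. *)
Theorem MGw_star_bounds (R : realType) (n : nat) (n_gt0 : (0 < n)%N)
    (e : rel 'I_n) (e_sym : symmetric e) (e_irr : irreflexive e)
    (w : 'I_n -> R) (w_gt0 : forall i, 0 < w i) (B : 'M[R]_n) : MGw_star e w B ->
  (exists2 r : nat, (1 <= r)%N & p_bound B r = ((alpha e w)^-1)%:E) /\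
  (exists r : nat, is_Theta B r (alpha e w)^-1).
Proof.
move=> [HB Bcrit].
have cert := qform_simplex_qm n_gt0 e_sym e_irr w_gt0 HB Bcrit.
have [S wS] := alpha_attained e w.
have Sz := simplex_wpoint n_gt0 e_irr w_gt0 wS.
have qz := qval_wpoint n_gt0 e_irr w_gt0 HB wS.
split.
  have [r r1 feas] := p_feasible_of_simplex_qm cert.
  exists r => //; apply/eqP; rewrite eq_le; apply/andP; split.
    apply: ge_ereal_sup => _ [l fl <-]; rewrite lee_fin -qz.
    exact: p_feasible_ub fl.
  by apply: ereal_sup_ubound; exists (alpha e w)^-1.
have Bs : B^T = B by case: HB.
have [r feas] := Theta_feasible_of_simplex_qm Bs cert.
by exists r; split=> // l fl; rewrite -qz; exact: Theta_feasible_ub fl.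
Qed.

Theorem theorem5p1 (R : realType) (n : nat) (n_gt0 : (0 < n)%N)
    (e : rel 'I_n) (e_sym : symmetric e) (e_irr : irreflexive e)
    (w : 'I_n -> R) (w_gt0 : forall i, 0 < w i) :
  (forall B : 'M[R]_n, MGw_star e w B ->
     (exists2 r : nat, (1 <= r)%N & p_bound B r = ((alpha e w)^-1)%:E) /\
     (exists r : nat, is_Theta B r (alpha e w)^-1)) /\
  ((forall i j : 'I_n, e i j -> ~~ wcritical e w i j) ->
   (forall B : 'M[R]_n, MGw e w B ->
      (exists2 r : nat, (1 <= r)%N & p_bound B r = ((alpha e w)^-1)%:E) /\
      (exists r : nat, is_Theta B r (alpha e w)^-1)) /\
   ((exists2 r : nat, (1 <= r)%N & p_bound (Bw e w) r = ((alpha e w)^-1)%:E) /\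
    (exists r : nat, is_Theta (Bw e w) r (alpha e w)^-1))).
Proof.
split=> [|no_crit]; first exact: MGw_star_bounds.
have star B : MGw e w B -> MGw_star e w B.
  move=> HB; split=> // i j crit; have /no_crit : e i j by case/andP: crit.
  by rewrite crit.
split=> [B /star|]; first exact: MGw_star_bounds.
exact/MGw_star_bounds/star/Bw_MGw.
Qed.
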